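(* Let $a,b\in\mathbb{R}$ with $b>1$. Then $$\pi=\frac{2\sqrt{b^4-1}\,\sqrt{1-2b^2\cos 2a+b^4}}{F_D^{(3)}\!\left(\tfrac12;\tfrac12,\tfrac12,\tfrac12;2\,\Big|\,\dfrac1{1-b^4},\dfrac1{1-b^2e^{-2ia}},\dfrac1{1-b^2e^{2ia}}\right)}\left(\frac{K\!\left(\dfrac{2b\sin a}{\sqrt{1-2b^2\cos 2a+b^4}}\right)}{\sqrt{1-2b^2\cos 2a+b^4}}-\frac{K\!\left(\dfrac{2b\cos a}{1+b^2}\right)}{1+b^2}\right).$$
   Context: $K(k)=\int_0^1\frac{dx}{\sqrt{(1-x^2)(1-k^2x^2)}}$ is the complete elliptic integral of the first kind, as a function of the modulus $k$. The Lauricella function of $n$ variables is $F_D^{(n)}(\alpha;\beta_1,\dots,\beta_n;\gamma\,|\,x_1,\dots,x_n)=\sum_{m_1,\dots,m_n\ge0}\frac{(\alpha)_{m_1+\cdots+m_n}(\beta_1)_{m_1}\cdots(\beta_n)_{m_n}}{(\gamma)_{m_1+\cdots+m_n}\,m_1!\cdots m_n!}x_1^{m_1}\cdots x_n^{m_n}$ for $|x_j|<1$, with $(x)_k$ the Pochhammer symbol. For $\operatorname{Re}\gamma>\operatorname{Re}\alpha>0$ it equals, and outside the region of convergence is defined by analytic continuation through, $\frac{\Gamma(\gamma)}{\Gamma(\alpha)\Gamma(\gamma-\alpha)}\int_0^1\frac{u^{\alpha-1}(1-u)^{\gamma-\alpha-1}}{(1-x_1u)^{\beta_1}\cdots(1-x_nu)^{\beta_n}}\,du$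 (principal branches, $x_j\notin[1,\infty)$). Here $i$ is the imaginary unit. *)

(* Defs.v *)
From HB Require Import structures.
From mathcomp Require Import all_boot all_order all_algebra.
From mathcomp Require Import all_classical all_reals all_analysis.
From mathcomp Require Export complex.

Set Implicit Arguments.
Unset Strict Implicit.
Unset Printing Implicit Defensive.

Import Order.TTheory GRing.Theory Num.Theory.
Import numFieldNormedType.Exports.

Local Open Scope classical_set_scope.
Local Open Scope complex_scope.
Local Open Scope ring_scope.

Section Lauricella.
Variable R : realType.
Implicit Types (z w alpha gamma : R[i]).

(* Complete elliptic integral of the first kind, as a function of the modulus.
   For |k| < 1 the integrand is integrable; at x = 1 it is 1 / 0 = 0, which
   does not affect the integral. *)
Definition ellipticK (k : R) : R :=
  \int[lebesgue_measure]_(x in `[0, 1])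
    (Num.sqrt ((1 - x ^+ 2) * (1 - k ^+ 2 * x ^+ 2)))^-1.

Definition cexp z : R[i] :=
  (expR (complex.Re z))%:C *
  (cos (complex.Im z) +i* sin (complex.Im z)).

(* Principal argument, in ]-pi, pi], of z != 0. *)
Definition carg z : R :=
  let t := acos (complex.Re z / Normc.normc z) in
  if 0 <= complex.Im z then t else - t.

Definition clog z : R[i] := ln (Normc.normc z) +i* carg z.

(* Principal branch of z ^ w; only meaningful for z != 0. *)
Definition cpow z w : R[i] := cexp (w * clog z).

Definition cintegral (D : set R) (f : R -> R[i]) : R[i] :=
  (\int[lebesgue_measure]_(u in D) complex.Re (f u)) +i*
  (\int[lebesgue_measure]_(u in D) complex.Im (f u)).

(* Euler's integral; only meaningful for Re z > 0. *)
Definition cGamma z : R[i] :=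
  cintegral `]0, +oo[ (fun t => cpow t%:C (z - 1) * (expR (- t))%:C).

Definition pochhammer z (k : nat) : R[i] := \prod_(i < k) (z + i%:R).

Definition lauricellaD_term n alpha (beta : n.-tuple R[i]) gamma
    (x : n.-tuple R[i]) (m : 'I_n -> nat) : R[i] :=
  (pochhammer alpha (\sum_j m j) * \prod_j pochhammer (tnth beta j) (m j)) /
  (pochhammer gamma (\sum_j m j) * \prod_j (m j)`!%:R) *
  \prod_j tnth x j ^+ m j.

(* The multiple series converges absolutely for |x_j| < 1, so it may be summed
   along the boxes {0, ..., N-1}^n. *)
Definition lauricellaD_series n alpha (beta : n.-tuple R[i]) gamma
    (x : n.-tuple R[i]) : R[i] :=
  limn (fun N : nat =>
    (\sum_(m : {ffun 'I_n -> 'I_N}) lauricellaD_term alpha beta gamma x (fun j => m j))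
      : R[i]^o).

(* Only meaningful for Re gamma > Re alpha > 0 and x_j not in [1, +oo[. *)
Definition lauricellaD_integral n alpha (beta : n.-tuple R[i]) gamma
    (x : n.-tuple R[i]) : R[i] :=
  cGamma gamma / (cGamma alpha * cGamma (gamma - alpha)) *
  cintegral `]0, 1[ (fun u =>
    cpow u%:C (alpha - 1) * cpow (1 - u%:C) (gamma - alpha - 1) /
    \prod_j cpow (1 - tnth x j * u%:C) (tnth beta j)).

(* F_D^(n) : the series in the polydisc |x_j| < 1, continued outside of it by
   the Euler integral. *)
Definition lauricellaD n alpha (beta : n.-tuple R[i]) gamma
    (x : n.-tuple R[i]) : R[i] :=
  if [forall j, `|tnth x j| < 1] then lauricellaD_series alpha beta gamma x
  else lauricellaD_integral alpha beta gamma x.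

End Lauricella.

(* Main.v *)
Require Import Defs.
From mathcomp Require Import all_boot all_order all_algebra.
From mathcomp Require Import all_classical all_reals all_analysis.
From mathcomp Require Import measurable_realfun ring lra.

(** Write c = cos (2 a), D^2 = 1 - 2 b^2 c + b^4 = |b^2 - e^(2 i a)|^2 and
    P(r) = b^4 - 2 b^2 c r^2 + r^4.  Everything is compared with one integral,

      J = int_0^(pi/2) 2 sin^2 t / sqrt (P(sin t) (b^4 - sin^2 t)) dt.

    Elliptic side.  Substitute x = D r / sqrt P(r) in the first K and
    x = (1 + b^2) r / (b^2 + r^2) in the second, with r = sin t.  In both cases
    the integrand collapses because
      P - D^2 r^2 = (b^2 + r^2)^2 - (1 + b^2)^2 r^2 = (1 - r^2) (b^4 - r^2),
      P - 4 b^2 sin^2 a r^2 = (b^2 - r^2)^2,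
      (b^2 + r^2)^2 - 4 b^2 cos^2 a r^2 = P,
    and the two terms K / D and K / (1 + b^2) become the integrals of
    (b^2 + r^2) / rad and (b^2 - r^2) / rad with the same radical
    ([ellipticK1], [ellipticK2]).  Their difference is J ([ellipticK_gap]).

    Hypergeometric side.  For a real x < 1 and a conjugate pair z, z^* with
    Re z < 1, the function F_D(1/2; 1/2, 1/2, 1/2; 2 | x, z, z^* ) equals
      (2 / pi) int_0^(pi/2) 2 cos^2 t /
                   (sqrt (1 - x sin^2 t) |1 - z sin^2 t|) dt     ([lauricellaDE]).
    For the values of x and z at hand, reflecting t into pi/2 - t turns this
    integral into sqrt (b^4 - 1) D J ([lauricellaD_gap]).  Since J > 0, dividing
    gives the formula for pi.

    The definition of F_D has two branches and both occur as a and b vary.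
    - Outside the polydisc, F_D is Euler's integral.  Put u = sin^2 t and use
      Gamma(2) = 1, Gamma(1/2) = sqrt pi, Gamma(3/2) = sqrt pi / 2; the principal
      square roots at z and z^* multiply to a modulus ([lauricellaD_integralE]).
    - Inside, F_D is a limit of sums over boxes.  The ratio (1/2)_k / (2)_k is a
      Wallis moment of 2 cos^2 t sin^(2k) t ([integral_wallis]), and under the
      integral sign a box sum factors into three truncations of the binomial
      series S of (1 - x)^(-1/2).  The square of a truncation is the truncated
      geometric series up to a tail, whence |S(w)|^2 -> 1 / |1 - w| and, for
      real w, S(w) -> 1 / sqrt (1 - w); dominated convergence concludes
      ([lauricellaD_seriesE]).

    The integrands of K, Gamma and Euler's integral are unbounded at end points,
    so the changes of variables are made on open intervals, for nonnegative
    integrands, by exhaustion with compact intervals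
    ([ge0_integral_subst_exhaust]). *)

Set Implicit Arguments.
Unset Strict Implicit.
Unset Printing Implicit Defensive.

Import Order.TTheory GRing.Theory Num.Theory.
Import numFieldNormedType.Exports.

Local Open Scope classical_set_scope.
Local Open Scope complex_scope.
Local Open Scope ring_scope.

(** * Change of variables on open intervals *)

Section Substitution.
Variable R : realType.
Implicit Types (F dF G : R -> R) (A B : set R).
Local Notation mu := (@lebesgue_measure R).

Lemma is_derive1_continuous (f : R -> R) (x df : R) :
  is_derive x (1 : R) f df -> {for x, continuous f}.
Proof.
by move=> /(@ex_derive _ _ _ _ _ _ _) /derivable1_diffP/differentiable_continuous.
Qed.

Lemma is_derive_exprn (f : R -> R) n (x df : R) :
  is_derive x (1 : R) f df ->
  is_derive x (1 : R) (fun t => f t ^+ n) (n%:R * f x ^+ n.-1 * df).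
Proof. by move=> dfx; rewrite -exprfctE; exact: (is_deriveX n dfx). Qed.

(** The compact version holds on each [u n, v n]; both sides then converge by
    monotone convergence because the integrands are nonnegative.  Only interior
    regularity is needed, so G may blow up at the ends of B. *)
Lemma ge0_integral_subst_exhaust F dF G A B (u v : nat -> R) :
    nonincreasing_seq u -> nondecreasing_seq v -> (forall n, u n <= v n) ->
    open A -> A = \bigcup_n `[u n, v n]%classic ->
    B = \bigcup_n `[F (u n), F (v n)]%classic ->
    (forall x, A x -> is_derive x (1 : R) F (dF x)) ->
    (forall x, A x -> {for x, continuous dF}) ->
    (forall x, A x -> 0 < dF x) ->
    (forall y, B y -> {for y, continuous G}) ->
    (forall y, B y -> 0 <= G y) ->
  (\int[mu]_(y in B) (G y)%:E = \int[mu]_(x in A) (G (F x) * dF x)%:E)%E.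
Proof.
move=> nu nv uv oA AE BE FA cdF dF0 cG G0.
have subA n x : u n <= x <= v n -> A x.
  by move=> xn; rewrite AE; exists n => //=; rewrite in_itv.
have subB n x : F (u n) <= x <= F (v n) -> B x.
  by move=> xn; rewrite BE; exists n => //=; rewrite in_itv.
have F'E x : A x -> F^`()%classic x = dF x.
  by move=> Ax; rewrite derive1E; have := FA _ Ax => /(@derive_val _ _ _ _ _ _ _).
have contF x : A x -> {for x, continuous F}.
  by move=> /FA; exact: is_derive1_continuous.
have incr n : {in `[u n, v n] &, {homo F : x y / x < y}}.
  apply: gtr0_derive1_lt_cc.
  - move=> x; rewrite in_itv/= => /andP[/ltW ? /ltW ?].
    by apply: (@ex_derive _ _ _ _ _ _ _ (FA x _)); apply: (subA n); apply/andP.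
  - move=> x; rewrite in_itv/= => /andP[/ltW ? /ltW ?].
    by rewrite F'E ?dF0//; apply: (subA n); apply/andP.
  - apply: continuous_in_subspaceT => x; rewrite inE/= in_itv/= => xn.
    exact/contF/(subA n).
have incrA x y : A x -> A y -> x <= y -> F x <= F y.
  rewrite le_eqVlt => + + /predU1P[->//|xy].
  rewrite {1 2}AE => -[n _ /=]; rewrite in_itv/= => /andP[ux xv].
  move=> [m _ /=]; rewrite in_itv/= => /andP[uy yv].
  apply/ltW; apply: (incr (maxn n m)) => //; rewrite in_itv/=.
    by rewrite (le_trans (nu _ _ (leq_maxl _ _)))//= (le_trans xv)// nv// leq_maxl.
  by rewrite (le_trans (nu _ _ (leq_maxr n _)))//= (le_trans yv)// nv// leq_maxr.
have Au n : A (u n) by apply: (subA n); rewrite lexx uv.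
have Av n : A (v n) by apply: (subA n); rewrite lexx uv.
have nearA x : A x -> \forall z \near x, A z.
  by move=> Ax; exact: open_nbhs_nbhs.
have contF' x : A x -> {for x, continuous F^`()%classic}.
  move=> Ax; rewrite /prop_for /continuous_at F'E//.
  apply: cvg_trans (cdF _ Ax); apply: near_eq_cvg.
  by near=> z; rewrite F'E//; near: z; exact: nearA.
have step n : (\int[mu]_(y in `[F (u n), F (v n)]) (G y)%:E =
               \int[mu]_(x in `[u n, v n]) (G (F x) * dF x)%:E)%E.
  rewrite (@integration_by_substitution_increasing _ F G)//.
  - apply: eq_integral => x; rewrite inE/= in_itv/= => xn.
    by rewrite !fctE F'E//; exact: (subA n).
  - move=> x; rewrite in_itv/= => /andP[/ltW ? /ltW ?].
    by apply: contF'; apply: (subA n); apply/andP.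
  - by apply/cvg_ex; exists (F^`()%classic (u n)); apply: cvg_at_right_filter; exact: contF'.
  - by apply/cvg_ex; exists (F^`()%classic (v n)); apply: cvg_at_left_filter; exact: contF'.
  - split.
    + move=> x; rewrite in_itv/= => /andP[/ltW ? /ltW ?].
      by apply: (@ex_derive _ _ _ _ _ _ _ (FA x _)); apply: (subA n); apply/andP.
    + by apply: cvg_at_right_filter; exact: contF.
    + by apply: cvg_at_left_filter; exact: contF.
  - apply: continuous_in_subspaceT => x; rewrite inE/= in_itv/= => xn.
    exact/cG/(subB n).
have FAB x : A x -> B (F x).
  move=> Ax; move: (Ax); rewrite AE BE => -[n _ /=]; rewrite in_itv/= => /andP[ux xv].
  by exists n => //=; rewrite in_itv/= !incrA.
have ndB : nondecreasing_seq (fun n => `[F (u n), F (v n)]%classic).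
  move=> n m nm; apply/subsetPset => x /=; rewrite !in_itv/= => /andP[ux xv].
  rewrite (le_trans _ ux) ?(le_trans xv)//; apply: incrA => //; [exact: nv|exact: nu].
have ndA : nondecreasing_seq (fun n => `[u n, v n]%classic).
  move=> n m nm; apply/subsetPset => x /=; rewrite !in_itv/= => /andP[ux xv].
  by rewrite (le_trans _ ux) ?(le_trans xv)//; [exact: nv|exact: nu].
have mf n : measurable_fun `[u n, v n]%classic (fun x => G (F x) * dF x).
  apply: subspace_continuous_measurable_fun => //.
  apply: continuous_in_subspaceT => x; rewrite inE/= in_itv/= => /(subA n) Ax.
  apply: (@continuousM _ _ (G \o F) dF); last exact: cdF.
  by apply: continuous_comp; [exact: contF|apply/cG/FAB].
have mG n : measurable_fun `[F (u n), F (v n)]%classic G.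
  apply: subspace_continuous_measurable_fun => //.
  by apply: continuous_in_subspaceT => x; rewrite inE/= in_itv/= => /(subB n) /cG.
have mGE n : measurable_fun `[F (u n), F (v n)]%classic (EFin \o G).
  exact/measurable_EFinP.
have mfE n : measurable_fun `[u n, v n]%classic (EFin \o (fun x => G (F x) * dF x)).
  exact/measurable_EFinP.
have cvB := ge0_nondecreasing_set_cvg_integral (mu := mu) ndB _ mGE.
have cvA := ge0_nondecreasing_set_cvg_integral (mu := mu) ndA _ mfE.
rewrite -BE in cvB; rewrite -AE in cvA.
apply/esym/(cvg_unique _ (cvA _ _)) => //.
- move=> n x/=; rewrite in_itv/= => xn; have Ax := subA n _ xn.
  by rewrite lee_fin mulr_ge0 ?(ltW (dF0 _ Ax))//; apply/G0/FAB.
- rewrite (_ : (fun i : nat => \int[mu]_(x in `[u i, v i]) _)%E =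
    (fun n => \int[mu]_(y in `[F (u n), F (v n)]) (G y)%:E)%E); last first.
    by apply/funext => n; rewrite step.
  apply: cvB => // n x/=; rewrite in_itv/= => xn.
  by rewrite lee_fin G0//; apply: (subB n).
Unshelve. all: by end_near. Qed.

Lemma ge0_integral_subst_oo F dF G (a b : R) : a < b ->
    {for a, continuous F} -> {for b, continuous F} ->
    {in `]a, b[, forall x, is_derive x (1 : R) F (dF x)} ->
    {in `]a, b[, forall x, {for x, continuous dF}} ->
    {in `]a, b[, forall x, 0 < dF x} ->
    {in `]F a, F b[, forall y, {for y, continuous G}} ->
    {in `]F a, F b[, forall y, 0 <= G y} ->
  (\int[mu]_(y in `]F a, F b[) (G y)%:E =
   \int[mu]_(x in `]a, b[) (G (F x) * dF x)%:E)%E.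
Proof.
move=> ab cFa cFb dFE cdF dF0 cG G0.
pose d := (b - a) / 2; have d0 : 0 < d by rewrite /d divr_gt0// subr_gt0.
pose e (n : nat) := d / n.+1%:R.
have e0 n : 0 < e n by rewrite /e divr_gt0.
have en n m : (n <= m)%N -> e m <= e n.
  by move=> nm; rewrite /e ler_pM2l// lef_pV2 ?posrE// ler_nat ltnS.
have ed n : e n <= d by rewrite /e ler_pdivrMr// ler_peMr ?(ltW d0) ?ler1n.
have abd : a + d = b - d by rewrite /d; field.
have cve : e n @[n --> \oo] --> (0 : R).
  rewrite -(mulr0 d); apply: cvgM; first exact: cvg_cst.
  exact: (@cvg_harmonic R).
have incr x y : a <= x -> x < y -> y <= b -> F x < F y.
  move=> ax xy yb.
  have F'E z : z \in `]a, b[ -> F^`()%classic z = dF z.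
    by move=> zab; rewrite derive1E; have := dFE _ zab => /(@derive_val _ _ _ _ _ _ _).
  have cF z : z \in `[a, b] -> {for z, continuous F}.
    rewrite in_itv/= => /andP[]; rewrite !le_eqVlt.
    move=> /predU1P[<-//|az] /predU1P[->//|zb].
    have zab : z \in `]a, b[ by rewrite in_itv/= az.
    by have := dFE _ zab; exact: is_derive1_continuous.
  have := @gtr0_derive1_lt_cc _ F a b; apply => //.
  - by move=> z zab; have /(@ex_derive _ _ _ _ _ _ _) := dFE _ zab.
  - by move=> z zab; rewrite F'E// dF0.
  - by apply: continuous_in_subspaceT => z; rewrite inE/= => /cF.
  - by rewrite in_itv/= ax (le_trans (ltW xy)).
  - by rewrite in_itv/= yb (le_trans ax (ltW xy)).
have ub n : a + e n < b by have := ed n; move: (e n) => t; rewrite /d; lra.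
have va n : a < b - e n by have := ed n; move: (e n) => t; rewrite /d; lra.
apply: (ge0_integral_subst_exhaust (u := fun n => a + e n) (v := fun n => b - e n)).
- by move=> n m nm; rewrite lerD2l en.
- by move=> n m nm; rewrite lerD2l lerN2 en.
- by move=> n; have := ed n; move: (e n) => t; rewrite /d; lra.
- exact: interval_open.
- apply/seteqP; split => x /=.
    rewrite in_itv/= => /andP[ax xb].
    have : \forall n \near \oo, e n < Num.min (x - a) (b - x).
      by apply: (cvgr_lt _ cve); rewrite lt_min !subr_gt0 ax.
    case=> N _ /(_ N (leqnn N)); rewrite lt_min => /andP[h1 h2].
    by exists N => //=; rewrite in_itv/=; apply/andP; split; lra.
  move=> [n _ /=]; rewrite !in_itv/= => /andP[h1 h2].
  by have := e0 n; move=> ?; apply/andP; split; lra.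
- apply/seteqP; split => y /=.
    rewrite in_itv/= => /andP[ay yb].
    have h1 : \forall n \near \oo, F (a + e n) < y.
      have : F (a + e n) @[n --> \oo] --> F a.
        by apply: continuous_cvg => //; rewrite -[X in _ --> X]addr0; apply: cvgD => //; exact: cvg_cst.
      by move/cvgr_lt; exact.
    have h2 : \forall n \near \oo, y < F (b - e n).
      have : F (b - e n) @[n --> \oo] --> F b.
        by apply: continuous_cvg => //; rewrite -[X in _ --> X]subr0; apply: cvgB => //; exact: cvg_cst.
      by move/cvgr_gt; exact.
    have [N _ /(_ N (leqnn N))[h h']] := filterI h1 h2.
    by exists N => //=; rewrite in_itv/= !ltW.
  move=> [n _ /=]; rewrite !in_itv/= => /andP[h1 h2].
  rewrite (lt_le_trans _ h1) ?(le_lt_trans h2)//.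
    by apply: incr => //; [exact/ltW/va|rewrite ltrBlDr ltrDl].
  by apply: incr => //; [rewrite ltrDl|exact/ltW/ub].
- by move=> x; exact: dFE.
- by move=> x; exact: cdF.
- by move=> x; exact: dF0.
- by move=> y; exact: cG.
- by move=> y; exact: G0.
Qed.

End Substitution.

(* A pointwise power does not unify with a power in the ring of functions. *)
#[export] Hint Extern 0 (is_derive _ _ (fun _ => _ ^+ _) _) =>
  (eapply is_derive_exprn) : typeclass_instances.

(** * Values of the Gamma function *)

Section Gamma.
Variable R : realType.
Implicit Types (F dF G : R -> R) (s t x y : R).
Local Notation mu := (@lebesgue_measure R).

Lemma ge0_integral_subst_0y F dF G :
    {for 0, continuous F} -> F 0 = 0 -> F x @[x --> +oo] --> +oo ->
    (forall x, 0 < x -> is_derive x (1 : R) F (dF x)) ->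
    (forall x, 0 < x -> {for x, continuous dF}) ->
    (forall x, 0 < x -> 0 < dF x) ->
    (forall y, 0 < y -> {for y, continuous G}) ->
    (forall y, 0 < y -> 0 <= G y) ->
  (\int[mu]_(y in `]0%R, +oo[) (G y)%:E =
   \int[mu]_(x in `]0%R, +oo[) (G (F x) * dF x)%:E)%E.
Proof.
move=> cF0 F0 Fy dFE cdF dF0 cG G0.
have incr x y : 0 <= x -> x < y -> F x < F y.
  move=> x0 xy.
  have F'E z : 0 < z -> F^`()%classic z = dF z.
    by move=> z0; rewrite derive1E; have := dFE _ z0 => /(@derive_val _ _ _ _ _ _ _).
  have cF z : 0 <= z -> {for z, continuous F}.
    rewrite le_eqVlt => /predU1P[<-//|z0].
    by have := dFE _ z0; exact: is_derive1_continuous.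
  have := @gtr0_derive1_lt_cc _ F 0 y; apply => //.
  - move=> z; rewrite in_itv/= => /andP[z0 _].
    by have /(@ex_derive _ _ _ _ _ _ _) := dFE _ z0.
  - by move=> z; rewrite in_itv/= => /andP[z0 _]; rewrite F'E// dF0.
  - by apply: continuous_in_subspaceT => z; rewrite inE/= in_itv/= => /andP[+ _] => /cF.
  - by rewrite in_itv/= x0 ltW.
  - by rewrite in_itv/= lexx ltW// (le_lt_trans x0).
have Fgt0 x : 0 < x -> 0 < F x by move=> x0; rewrite -F0 incr.
pose e (n : nat) : R := n.+1%:R^-1.
have e0 n : 0 < e n by rewrite /e invr_gt0.
have cve : e n @[n --> \oo] --> (0 : R) by exact: (@cvg_harmonic R).
have e1 n : e n <= 1 by rewrite /e invf_le1// ler1n.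
apply: (ge0_integral_subst_exhaust (u := e) (v := fun n => n.+1%:R)).
- by move=> n m nm; rewrite /e lef_pV2 ?posrE// ler_nat ltnS.
- by move=> n m nm; rewrite ler_nat ltnS.
- by move=> n; rewrite (le_trans (e1 n))// ler1n.
- exact: interval_open.
- apply/seteqP; split => x /=.
    rewrite in_itv/= andbT => x0.
    have h1 : \forall n \near \oo, e n < x by exact: (cvgr_lt _ cve).
    have h2 : \forall n \near \oo, x <= n%:R :> R by exact: nbhs_infty_ger.
    have [N _ /(_ N (leqnn N))[h h']] := filterI h1 h2.
    exists N => //=; rewrite in_itv/= ltW//= (le_trans h')// ler_nat//.
  by move=> [n _ /=]; rewrite !in_itv/= andbT => /andP[h1 h2]; exact: lt_le_trans h1.
- apply/seteqP; split => y /=.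
    rewrite in_itv/= andbT => y0.
    have h1 : \forall n \near \oo, F (e n) < y.
      have : F (e n) @[n --> \oo] --> F 0 by apply: continuous_cvg => //.
      by rewrite F0 => /cvgr_lt; exact.
    have h2 : \forall n \near \oo, y <= F (n%:R : R).
      have : F (n%:R : R) @[n --> \oo] --> +oo.
        by apply: cvg_comp Fy; exact: cvgr_idn.
      by move/cvgryPge; exact.
    have [N _ /(_ N (leqnn N))[h h']] := filterI h1 h2.
    exists N => //=; rewrite in_itv/= ltW//= (le_trans h')// ltW// incr//.
    by rewrite ltr_nat.
  move=> [n _ /=]; rewrite !in_itv/= andbT => /andP[h1 h2].
  by rewrite (lt_le_trans _ h1)// Fgt0.
- by move=> x /=; rewrite in_itv/= andbT; exact: dFE.
- by move=> x /=; rewrite in_itv/= andbT; exact: cdF.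
- by move=> x /=; rewrite in_itv/= andbT; exact: dF0.
- by move=> y /=; rewrite in_itv/= andbT; exact: cG.
- by move=> y /=; rewrite in_itv/= andbT; exact: G0.
Qed.

Lemma carg_gt0 t : 0 < t -> carg t%:C = 0.
Proof.
by move=> t0; rewrite /carg/= lexx expr0n/= addr0 sqrtr_sqr gtr0_norm// divff ?gt_eqF// acos1.
Qed.

Lemma cexp_real t : cexp t%:C = (expR t)%:C.
Proof. by rewrite /cexp/= cos0 sin0 mulr1. Qed.

Lemma cpow_gt0 t s : 0 < t -> cpow t%:C s%:C = (t `^ s)%:C.
Proof.
move=> t0; rewrite /cpow /clog carg_gt0//= complexr0.
rewrite expr0n/= addr0 sqrtr_sqr gtr0_norm// -rmorphM/= cexp_real.
by rewrite /powR gt_eqF.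
Qed.

Lemma cGamma_real s : cGamma s%:C =
  (\int[mu]_(t in `]0%R, +oo[) (t `^ (s - 1) * expR (- t)))%:C.
Proof.
have E t : 0 < t -> cpow t%:C (s%:C - 1) * (expR (- t))%:C =
    (t `^ (s - 1) * expR (- t))%:C.
  by move=> t0; rewrite rmorphM/= -cpow_gt0// rmorphB rmorph1.
rewrite /cGamma /cintegral; congr (_ +i* _).
  by apply: eq_Rintegral => t /set_mem; rewrite [X in X -> _]/= in_itv [X in X -> _]/= andbT => t0; rewrite E.
rewrite (@eq_Rintegral _ _ _ mu _ (fun=> 0)) ?Rintegral_cst ?mul0r//.
by move=> t /set_mem; rewrite [X in X -> _]/= in_itv [X in X -> _]/= andbT => t0; rewrite E.
Qed.

(** The second moment of the Gaussian reduces to the Gaussian integral because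
    the derivative of - x exp (- x^2) is (2 x^2 - 1) exp (- x^2). *)
Lemma integral_gauss_sqr :
  (\int[mu]_(x in `[0%R, +oo[) (2 * x ^+ 2 * gauss_fun x)%:E =
   (Num.sqrt pi / 2)%:E)%E.
Proof.
pose f x := 2 * x ^+ 2 * gauss_fun x.
have cg : continuous (@gauss_fun R) by exact: continuous_gauss_fun.
have cf : continuous f.
  move=> x; apply: (@continuousM _ _ (fun x => 2 * x ^+ 2) gauss_fun); last exact: cg.
  by apply: (@is_derive1_continuous _ _ _ (4 * x)); apply: is_derive_eq; rewrite /GRing.scale/=; ring.
have f0 x : 0 <= f x by apply: mulr_ge0; [rewrite mulr_ge0 ?sqr_ge0|exact: gauss_fun_ge0].
have mf : measurable_fun setT f by exact: continuous_measurable_fun.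
have intc g n : continuous g -> mu.-integrable `[0%R, n%:R : R] (EFin \o g).
  move=> cg'; apply: continuous_compact_integrable; first exact: segment_compact.
  exact: continuous_subspaceT.
have h1 := ge0_cvgn_integral (mu := mu) f0 mf.
have h2 := ge0_cvgn_integral (mu := mu) (@gauss_fun_ge0 R) (@measurable_gauss_fun R).
rewrite integral0y_gauss in h2.
move: h1; rewrite -cvg_shiftS => h1.
apply: (cvg_unique _ h1) => //.
have step n : (\int[mu]_(x in `[0%R, n.+1%:R]) (f x)%:E =
    \int[mu]_(x in `[0%R, n.+1%:R]) (gauss_fun x)%:E
      - (n.+1%:R * gauss_fun (n.+1%:R : R))%:E)%E.
  have n0 : 0 < n.+1%:R :> R by rewrite ltr0n.
  pose F x := - (x * gauss_fun x).
  have dF x : is_derive x (1 : R) F (f x - gauss_fun x).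
    rewrite /F /gauss_fun; apply: is_derive_eq.
    by rewrite /f /gauss_fun /GRing.scale/=; ring.
  have := @continuous_FTC2 _ (fun x => f x - gauss_fun x) F 0 n.+1%:R n0.
  rewrite integralB_EFin//; [|exact: intc|exact: intc].
  have -> : F 0 = 0 by rewrite /F mul0r oppr0.
  rewrite sube0 => FTC.
  rewrite -EFinN -/(F _) -FTC//.
  - rewrite addeC subeK//; apply: integrable_fin_num => //; exact: intc.
  - by apply: continuous_subspaceT => x; apply: continuousB; [exact: cf|exact: cg].
  - split.
    + by move=> x _; exact: (@ex_derive _ _ _ _ _ _ _ (dF x)).
    + by apply: cvg_at_right_filter; apply: is_derive1_continuous (dF 0).
    + by apply: cvg_at_left_filter; apply: is_derive1_continuous (dF n.+1%:R).
  - by move=> x _; rewrite derive1E; apply: derive_val.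
have lim0 : n.+1%:R * gauss_fun (n.+1%:R : R) @[n --> \oo] --> (0 : R).
  apply: (@squeeze_cvgr _ _ _ _ (fun=> 0) (fun n => n.+1%:R^-1)).
  - apply: nearW => n; rewrite mulr_ge0 ?gauss_fun_ge0//=.
    rewrite /gauss_fun expRN ler_pdivrMr ?expR_gt0// ler_pdivlMl//.
    rewrite -expr2 (le_trans _ (expR_ge1Dx _))// lerDr//.
  - exact: cvg_cst.
  - exact: (@cvg_harmonic R).
have h3 : (\int[mu]_(x in `[0%R, n.+1%:R]) (gauss_fun x)%:E
    - (n.+1%:R * gauss_fun (n.+1%:R : R))%:E @[n --> \oo] -->
    (Num.sqrt pi / 2)%:E - 0%:E)%E.
  apply: cvgeB => //; last by apply: cvg_EFin => //; exact: nearW.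
  by move: h2; rewrite -cvg_shiftS.
rewrite sube0 in h3.
move: h3; apply: cvg_trans; apply: near_eq_cvg; apply: nearW => n.
by rewrite -step.
Qed.

Lemma cvg_onep_expRN : (1 + x) * expR (- x) @[x --> +oo] --> (0 : R).
Proof.
apply: (@squeeze_cvgr _ _ _ _ (fun=> 0) (fun x => 2 * expR (- (2^-1 * x)))).
- near=> x.
  have x0 : 0 <= x by near: x; exact: nbhs_pinfty_ge.
  rewrite mulr_ge0 ?expR_ge0 ?addr_ge0//=.
  rewrite [in leLHS](_ : - x = - (2^-1 * x) + - (2^-1 * x)); last by field.
  rewrite expRD mulrA ler_pM2r ?expR_gt0// expRN ler_pdivrMr ?expR_gt0//.
  have := expR_ge1Dx (2^-1 * x); lra.
- exact: cvg_cst.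
- rewrite -(mulr0 2); apply: cvgM; first exact: cvg_cst.
  apply: (@cvg_comp _ _ _ (fun x : R => 2^-1 * x) (fun x => expR (- x))); last exact: cvgr_expR.
  by apply: gt0_cvgMry => //; exact: cvg_id.
Unshelve. all: by end_near. Qed.

Lemma cGamma2 : cGamma 2 = 1 :> R[i].
Proof.
rewrite (_ : 2 = (2 : R)%:C); last by rewrite rmorphMn.
rewrite cGamma_real.
pose F x := - ((1 + x) * expR (- x)).
have dF x : is_derive x (1 : R) F (x * expR (- x)).
  rewrite /F; apply: is_derive_eq; rewrite /GRing.scale/=; ring.
have cf : continuous (fun x : R => x * expR (- x)).
  move=> x; apply: (@is_derive1_continuous _ _ _ ((1 - x) * expR (- x))).
  by apply: is_derive_eq; rewrite /GRing.scale/=; ring.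
rewrite (@eq_Rintegral _ _ _ mu _ (fun x => x * expR (- x))); last first.
  move=> x; rewrite inE/= in_itv/= andbT => x0.
  by rewrite (_ : 2 - 1 = 1); [rewrite powRr1// ltW|ring].
rewrite /Rintegral integral_itv_obnd_cbnd; last first.
  by apply/measurable_EFinP; apply: measurable_funTS; exact: (continuous_measurable_fun cf).
rewrite (@ge0_continuous_FTC2y _ (fun x => x * expR (- x)) F 0 0).
- by rewrite -EFinB /F addr0 oppr0 expR0 mulr1 sub0r opprK.
- by move=> x x0; rewrite mulr_ge0 ?expR_ge0.
- exact: continuous_subspaceT.
- by rewrite -oppr0; apply: cvgN; exact: cvg_onep_expRN.
- by move=> x x0; exact: (@ex_derive _ _ _ _ _ _ _ (dF x)).
- by apply: cvg_at_right_filter; exact: is_derive1_continuous (dF 0).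
- by move=> x x0; rewrite derive1E; apply: derive_val.
Qed.

(** Putting t = x^2 turns Gamma at half-integers into Gaussian moments.  The
    function H stands for 2 x G(x^2): it extends continuously to 0 even when G
    is singular there. *)
Lemma integral_expRN_sqr G H : (forall y, 0 < y -> {for y, continuous G}) ->
    (forall y, 0 < y -> 0 <= G y) ->
    continuous H -> (forall x, 0 < x -> 2 * x * G (x ^+ 2) = H x) ->
  (\int[mu]_(t in `]0%R, +oo[) (G t * expR (- t))%:E =
   \int[mu]_(x in `[0%R, +oo[) (H x * gauss_fun x)%:E)%E.
Proof.
move=> cG G0 cH HE.
rewrite -[RHS]integral_itv_obnd_cbnd; last first.
  apply/measurable_EFinP; apply: measurable_funTS.
  apply: continuous_measurable_fun => x.
  by apply: (@continuousM _ _ H);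
    [exact: cH|exact: continuous_gauss_fun].
have dsqr x : 0 < x -> is_derive x (1 : R) (fun x => x ^+ 2) (2 * x).
  by move=> _; apply: is_derive_eq; rewrite /GRing.scale/=; ring.
have cdbl x : 0 < x -> {for x, continuous (fun x : R => 2 * x)}.
  move=> _; apply: (@is_derive1_continuous _ _ _ 2).
  by apply: is_derive_eq; rewrite /GRing.scale/=; ring.
have cGE y : 0 < y -> {for y, continuous (fun t => G t * expR (- t))}.
  move=> y0; apply: (@continuousM _ _ G (fun t => expR (- t))); first exact: cG.
  apply: (@is_derive1_continuous _ _ _ (- expR (- y))).
  by apply: is_derive_eq; rewrite /GRing.scale/=; ring.
have GE0 y : 0 < y -> 0 <= G y * expR (- y).
  by move=> y0; rewrite mulr_ge0 ?expR_ge0 ?G0.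
rewrite (ge0_integral_subst_0y _ _ _ dsqr cdbl _ cGE GE0).
- apply: eq_integral => x; rewrite inE/= in_itv/= andbT => x0.
  by rewrite -HE// /gauss_fun; congr EFin; ring.
- exact: exprn_continuous.
- by rewrite expr0n.
- exact: cvgr_expr2.
- by move=> x x0; rewrite mulr_gt0.
Qed.

Lemma cGamma_half : cGamma (2^-1) = (Num.sqrt pi)%:C :> R[i].
Proof.
rewrite (_ : 2^-1 = (2^-1 : R)%:C); last by rewrite fmorphV rmorphMn.
rewrite cGamma_real.
rewrite (@eq_Rintegral _ _ _ mu _ (fun t => (Num.sqrt t)^-1 * expR (- t))); last first.
  move=> t; rewrite inE/= in_itv/= andbT => t0.
  by rewrite (_ : 2^-1 - 1 = - 2^-1); [rewrite powRN powR12_sqrt// ltW|field].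
rewrite /Rintegral (@integral_expRN_sqr _ (fun=> 2)).
- under eq_integral do rewrite EFinM.
  rewrite ge0_integralZl_EFin//; last 2 first.
  + by move=> x _; rewrite lee_fin gauss_fun_ge0.
  + by apply/measurable_EFinP/measurable_funTS; exact: measurable_gauss_fun.
  by rewrite integral0y_gauss -EFinM/=; congr (_%:C); field.
- move=> y y0; apply: cvgV; first by rewrite gt_eqF ?sqrtr_gt0.
  exact: sqrt_continuous.
- by move=> y _; rewrite invr_ge0.
- by move=> x; exact: cvg_cst.
- by move=> x x0; rewrite sqrtr_sqr gtr0_norm//; field; rewrite gt_eqF.
Qed.

Lemma cGamma_three_half : cGamma (2 - 2^-1) = (Num.sqrt pi / 2)%:C :> R[i].
Proof.
rewrite (_ : 2 - 2^-1 = (2 - 2^-1 : R)%:C); last by rewrite rmorphB fmorphV rmorphMn.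
rewrite cGamma_real.
rewrite (@eq_Rintegral _ _ _ mu _ (fun t => Num.sqrt t * expR (- t))); last first.
  move=> t; rewrite inE/= in_itv/= andbT => t0.
  by rewrite (_ : 2 - 2^-1 - 1 = 2^-1); [rewrite powR12_sqrt// ltW|field].
rewrite /Rintegral (@integral_expRN_sqr _ (fun x => 2 * x ^+ 2)).
- by rewrite integral_gauss_sqr.
- by move=> y y0; exact: sqrt_continuous.
- by [].
- move=> x; apply: (@is_derive1_continuous _ _ _ (4 * x)).
  by apply: is_derive_eq; rewrite /GRing.scale/=; ring.
- by move=> x x0; rewrite sqrtr_sqr gtr0_norm//; ring.
Qed.

End Gamma.

(** * The binomial series of the inverse square root *)

Section BinomialSeries.
Variable K : numFieldType.
Implicit Types (x : K) (n N : nat).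

(** This is (1/2)_n / n!, the coefficient of x^n in (1 - x)^(-1/2). *)
Definition half_coef n : K := \prod_(i < n) ((2^-1 + i%:R) / i.+1%:R).

Definition half_poly N : {poly K} := \poly_(i < N) half_coef i.

Lemma half_coef0 : half_coef 0 = 1.
Proof. by rewrite /half_coef big_ord0. Qed.

Lemma half_coefS n : half_coef n.+1 = half_coef n * ((2^-1 + n%:R) / n.+1%:R).
Proof. by rewrite /half_coef big_ord_recr. Qed.

Lemma half_coef_ge0 n : 0 <= half_coef n.
Proof.
apply: prodr_ge0 => i _; rewrite divr_ge0// addr_ge0// ?invr_ge0//.
Qed.

Lemma half_coef_le1 n : half_coef n <= 1.
Proof.
apply: prodr_ile1 => i _; rewrite divr_ge0 ?addr_ge0 ?invr_ge0//=.
by rewrite ler_pdivrMr// mul1r -[leRHS]nat1r lerD2r invf_le1// ler1n.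
Qed.

(** Coefficientwise form of ((1 - x)^(-1/2))^2 = 1 / (1 - x).  The recurrence
    (n + 1) c_(n + 1) = (n + 1/2) c_n gives n a_n = n a_(n - 1) for the
    convolution a. *)
Lemma half_coef_conv n : \sum_(i < n.+1) half_coef i * half_coef (n - i) = 1.
Proof.
(* Symmetrize with i replaced by m - i. *)
have sym m : 2 * (\sum_(i < m.+1) i%:R * (half_coef i * half_coef (m - i))) =
    m%:R * \sum_(i < m.+1) half_coef i * half_coef (m - i).
  rewrite mulr_natl mulr2n {2}(reindex_inj rev_ord_inj)/= -big_split mulr_sumr/=.
  apply: eq_bigr => i _; have im : (i <= m)%N by rewrite -ltnS.
  rewrite subSS subKn// natrB//; ring.
elim: n => [|n IH]; first by rewrite big_ord1 subn0 half_coef0 mulr1.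
apply: (@mulfI _ n.+1%:R); first by rewrite pnatr_eq0.
rewrite -sym big_ord_recl mul0r add0r mulr1.
have E (i : 'I_n.+1) : i.+1%:R * (half_coef i.+1 * half_coef (n - i)) =
    2^-1 * (half_coef i * half_coef (n - i)) +
      i%:R * (half_coef i * half_coef (n - i)).
  by rewrite half_coefS; field; rewrite nat1r pnatr_eq0.
under eq_bigr do rewrite lift0 subSS E.
by rewrite big_split/= mulrDr sym -mulr_sumr IH !mulr1 divff// addrC natr1.
Qed.

Lemma coef_half_sqr N k : (k < N)%N -> (half_poly N * half_poly N)`_k = 1.
Proof.
move=> kN; rewrite coefM -[RHS](half_coef_conv k).
apply: eq_bigr => i _; rewrite !coef_poly (leq_ltn_trans (leq_subr _ _) kN).
by rewrite (leq_ltn_trans _ kN)// -ltnS.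
Qed.

(** Above degree N the coefficients of the square are partial sums of the full
    convolution, hence still at most 1. *)
Lemma coef_half_sqr_itv N k : 0 <= (half_poly N * half_poly N)`_k <= 1.
Proof.
have c_itv i : 0 <= (half_poly N)`_i <= half_coef i.
  by rewrite coef_poly; case: ifP => _; rewrite ?lexx half_coef_ge0.
rewrite coefM; apply/andP; split.
  by apply: sumr_ge0 => i _; rewrite mulr_ge0//; case/andP: (c_itv i) (c_itv (k - i)%N) => ? _ /andP[].
rewrite -[leRHS](half_coef_conv k); apply: ler_sum => i _.
by apply: ler_pM; case/andP: (c_itv i) (c_itv (k - i)%N) => ? ? /andP[].
Qed.

Lemma geometric_le x n : `|x| <= 1 -> (1 - `|x|) * \sum_(i < n) `|x| ^+ i <= 1.
Proof.
move=> x1; rewrite -opprB mulNr -subrX1 opprB lerBlDr lerDl exprn_ge0//.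
Qed.

Lemma half_poly_bound N x : `|x| <= 1 -> (1 - `|x|) * `|(half_poly N).[x]| <= 1.
Proof.
move=> x1; apply: le_trans (geometric_le N x1).
rewrite ler_wpM2l ?subr_ge0// horner_poly (le_trans (ler_norm_sum _ _ _))//.
apply: ler_sum => i _; rewrite normrM normrX ger0_norm ?half_coef_ge0//.
by rewrite ler_piMl ?exprn_ge0// half_coef_le1.
Qed.

(** The square of the truncation agrees with the geometric series up to degree N,
    and what remains is dominated by a geometric tail.  The factor 1 - |x| on
    the left avoids a division. *)
Lemma half_poly_sqr N x : `|x| <= 1 ->
  (1 - `|x|) * `|(1 - x) * (half_poly N).[x] ^+ 2 - 1| <= 3 * `|x| ^+ N.
Proof.
move=> x1; have r0 := normr_ge0 x.
have r1 : 0 <= 1 - `|x| by rewrite subr_ge0.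
(* The tail of the square, from degree N on. *)
pose T := \sum_(i < N) (half_poly N * half_poly N)`_(N + i) * x ^+ (N + i).
have -> : (1 - x) * (half_poly N).[x] ^+ 2 - 1 = - x ^+ N + (1 - x) * T.
  have -> : (half_poly N).[x] ^+ 2 = \sum_(i < N) x ^+ i + T.
    rewrite expr2 -hornerM (@horner_coef_wide _ (N + N)); last first.
      by rewrite (leq_trans (size_polyMleq _ _))// (leq_trans (leq_pred _))// leq_add ?size_poly.
    rewrite big_split_ord/=; congr (_ + _); apply: eq_bigr => i _.
    by rewrite coef_half_sqr// mul1r.
  have G : (1 - x) * \sum_(i < N) x ^+ i = 1 - x ^+ N.
    by rewrite -opprB mulNr -subrX1 opprB.
  by rewrite mulrDr G; ring.
have hT : (1 - `|x|) * `|T| <= `|x| ^+ N.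
  rewrite (@le_trans _ _ (`|x| ^+ N * ((1 - `|x|) * \sum_(i < N) `|x| ^+ i)))//; last first.
    by rewrite ler_piMr ?exprn_ge0// geometric_le.
  rewrite mulrCA ler_wpM2l// mulr_sumr (le_trans (ler_norm_sum _ _ _))//.
  apply: ler_sum => i _; rewrite normrM normrX exprD.
  have /andP[a0 a1] := coef_half_sqr_itv N (N + i).
  by rewrite ger0_norm// ler_piMl// mulr_ge0 ?exprn_ge0.
have h2 : `|1 - x| <= 2.
  by rewrite (le_trans (ler_normB _ _))// normr1 -[2]/(1 + 1) lerD2l.
apply: (@le_trans _ _ ((1 - `|x|) * (`|x| ^+ N + 2 * `|T|))).
  rewrite ler_wpM2l// (le_trans (ler_normD _ _))// normrN normrX lerD2l normrM.
  by rewrite ler_wpM2r.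
rewrite mulrDr [X in _ + X]mulrCA.
rewrite (_ : 3 * _ = `|x| ^+ N + 2 * `|x| ^+ N); last by ring.
by rewrite lerD ?ler_wpM2l// ler_piMl ?exprn_ge0// lerBlDr lerDl.
Qed.

End BinomialSeries.

Section RealBinomialSeries.
Variable R : realFieldType.
Implicit Types (x : R) (N : nat).

(** Fixes the sign of the square root in the limit.  For negative x, consecutive
    terms are grouped in pairs of nonnegative sum. *)
Lemma half_poly_ge0 N x : -1 <= x -> 0 <= (half_poly R N).[x].
Proof.
move=> x1; rewrite horner_poly; have [x0|/ltW x0] := leP 0 x.
  by apply: sumr_ge0 => i _; rewrite mulr_ge0 ?half_coef_ge0 ?exprn_ge0.
have even_ge0 n : 0 <= x ^+ n.*2 by rewrite -mul2n exprM exprn_ge0 ?sqr_ge0.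
have H n : 0 <= \sum_(i < n.*2) half_coef R i * x ^+ i.
  elim: n => [|n IH]; first by rewrite big_ord0.
  rewrite doubleS 2!big_ord_recr/= -addrA addr_ge0//.
  rewrite half_coefS exprSr.
  set c := half_coef R n.*2.
  set q := (2^-1 + _) / _.
  have q0 : 0 <= q by rewrite divr_ge0 ?addr_ge0 ?invr_ge0.
  have q1 : q <= 1.
    by rewrite ler_pdivrMr// mul1r -[leRHS]nat1r lerD2r invf_le1// ler1n.
  rewrite (_ : _ + _ = c * x ^+ n.*2 * (1 + q * x)); last by ring.
  rewrite !mulr_ge0 ?half_coef_ge0//; nra.
rewrite -[N]odd_double_half; case: (odd N); rewrite ?add0n ?add1n;
  last exact: H.
by rewrite big_ord_recr/= addr_ge0 ?mulr_ge0 ?half_coef_ge0 ?even_ge0 ?H.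
Qed.

End RealBinomialSeries.

Section ComplexAux.
Variable R : realType.
Implicit Types (x r : R) (z w : R[i]) (N : nat).
Local Notation normc := (@Normc.normc R).

Lemma normc_ge0 z : 0 <= normc z.
Proof. by case: z => a b; exact: sqrtr_ge0. Qed.

Lemma normcE z : `|z| = (normc z)%:C.
Proof. by case: z => a b; rewrite normc_def. Qed.

Lemma normc_real x : normc x%:C = `|x|.
Proof. by rewrite /= expr0n/= addr0 sqrtr_sqr. Qed.

Lemma normc_conj z : normc (conjc z) = normc z.
Proof. by case: z => a b /=; rewrite sqrrN. Qed.

Lemma mul_conjc z : z * (conjc z) = (normc z ^+ 2)%:C.
Proof.
case: z => a b /=; rewrite sqr_sqrtr ?addr_ge0 ?sqr_ge0//.
by simpc; congr (_ +i* _); ring.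
Qed.

Lemma half_coef_real n : half_coef R[i] n = (half_coef R n)%:C.
Proof.
rewrite /half_coef rmorph_prod; apply: eq_bigr => i _.
by rewrite rmorphM/= fmorphV rmorphD fmorphV !rmorph_nat.
Qed.

Lemma half_poly_real N x : (half_poly R[i] N).[x%:C] = ((half_poly R N).[x])%:C.
Proof.
rewrite !horner_poly rmorph_sum; apply: eq_bigr => i _.
by rewrite rmorphM/= rmorphXn half_coef_real.
Qed.

Lemma half_poly_conj N z : (half_poly R[i] N).[conjc z] = conjc (half_poly R[i] N).[z].
Proof.
rewrite !horner_poly rmorph_sum; apply: eq_bigr => i _.
by rewrite rmorphM/= rmorphXn/= half_coef_real conjc_real.
Qed.

Lemma half_poly_sqr_normc N z : normc z < 1 ->
  `|normc (1 - z) * normc (half_poly R[i] N).[z] ^+ 2 - 1| <=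
  3 / (1 - normc z) * normc z ^+ N.
Proof.
move=> z1.
have z1' : `|z| <= 1 by rewrite normcE -[1](rmorph1 (real_complex R)) lecR ltW.
have := half_poly_sqr N z1'; rewrite !normcE.
rewrite -[X in X - _](rmorph1 (real_complex R)) -rmorphB -rmorphM/=.
rewrite -[3](rmorph_nat (real_complex R)) -rmorphXn/= -rmorphM lecR => h.
have d0 : 0 < 1 - normc z by rewrite subr_gt0.
rewrite mulrAC ler_pdivlMr// mulrC; apply: le_trans h.
rewrite ler_wpM2l ?(ltW d0)//.
set w := (1 - z) * _.
have -> : normc (1 - z) * normc (half_poly R[i] N).[z] ^+ 2 = normc w.
  by rewrite /w expr2 !Normc.normcM.
have h1 := le_normcD (w - 1) 1; have h2 := le_normcD (1 - w) w.
rewrite subrK Normc.normc1 in h1; rewrite subrK Normc.normc1 in h2.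
rewrite ler_norml; apply/andP; split; last by lra.
by rewrite -(normcN (w - 1)) opprB; lra.
Qed.

Lemma half_poly_normc_le N z : normc z < 1 ->
  normc (half_poly R[i] N).[z] <= (1 - normc z)^-1.
Proof.
move=> z1.
have z1' : `|z| <= 1 by rewrite normcE -[1](rmorph1 (real_complex R)) lecR ltW.
have := half_poly_bound N z1'; rewrite !normcE.
rewrite -[1](rmorph1 (real_complex R)) -rmorphB -rmorphM/= lecR => h.
by rewrite -[leRHS]mul1r ler_pdivlMr ?subr_gt0// mulrC.
Qed.

Lemma half_poly_normc_cvg z : normc z < 1 ->
  normc (half_poly R[i] N).[z] ^+ 2 @[N --> \oo] --> (normc (1 - z))^-1.
Proof.
move=> z1.
have n0 : normc (1 - z) != 0.
  apply/eqP => /Normc.eq0_normc/eqP; rewrite subr_eq0 => /eqP z1E.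
  by move: z1; rewrite -z1E Normc.normc1 ltxx.
have cv : normc (1 - z) * normc (half_poly R[i] N).[z] ^+ 2 - 1 @[N --> \oo] --> (0 : R).
  apply: norm_cvg0.
  apply: (@squeeze_cvgr _ _ _ _ (fun=> 0) (fun N => 3 / (1 - normc z) * normc z ^+ N)).
  - by apply: nearW => N; rewrite normr_ge0/= half_poly_sqr_normc.
  - exact: cvg_cst.
  - rewrite -(mulr0 (3 / (1 - normc z))); apply: cvgM; first exact: cvg_cst.
    by apply: cvg_expr; rewrite ger0_norm ?normc_ge0.
rewrite (_ : (fun N => _) = (fun N => (normc (1 - z))^-1 *
   ((normc (1 - z) * normc (half_poly R[i] N).[z] ^+ 2 - 1) + 1))); last first.
  by apply/funext => N; rewrite subrK mulKf.
rewrite (_ : nbhs (normc (1 - z))^-1 = nbhs ((normc (1 - z))^-1 * (0 + 1))); last first.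
  by rewrite add0r mulr1.
by apply: cvgM; [exact: cvg_cst|apply: cvgD => //; exact: cvg_cst].
Qed.

(** For real arguments, the limit of the square determines the limit, since the
    truncations are nonnegative. *)
Lemma half_poly_cvg x : `|x| < 1 ->
  (half_poly R N).[x] @[N --> \oo] --> (Num.sqrt (1 - x))^-1.
Proof.
move=> x1.
have x1' : normc x%:C < 1 by rewrite normc_real.
have /ltr_normlP[xl xr] := x1.
have d0 : 0 < 1 - x by rewrite subr_gt0.
have := half_poly_normc_cvg x1'.
rewrite -[X in normc (X - _)](rmorph1 (real_complex R)) -rmorphB normc_real gtr0_norm// => h.
rewrite -sqrtrV ?(ltW d0)//.
have : Num.sqrt (normc (half_poly R[i] N).[x%:C] ^+ 2) @[N --> \oo] --> Num.sqrt ((1 - x)^-1).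
  by apply: continuous_cvg => //; exact: sqrt_continuous.
apply: cvg_trans; apply: near_eq_cvg; apply: nearW => N.
rewrite half_poly_real normc_real real_normK ?num_real// sqrtr_sqr ger0_norm//.
by rewrite half_poly_ge0//; lra.
Qed.

End ComplexAux.

(** * Wallis moments *)

Section Moments.
Variable R : realType.
Implicit Types (f g : R -> R) (s t x y : R).
Local Notation mu := (@lebesgue_measure R).

Lemma continuous_integrable_itv f (a b : R) :
  continuous f -> mu.-integrable `[a, b] (EFin \o f).
Proof.
move=> cf; apply: continuous_compact_integrable; first exact: segment_compact.
exact: continuous_subspaceT.
Qed.

Lemma Rintegral_FTC f F (a b : R) : a < b -> continuous f ->
  (forall x, is_derive x (1 : R) F (f x)) ->
  \int[mu]_(x in `[a, b]) f x = F b - F a.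
Proof.
move=> ab cf dF; rewrite /Rintegral (@continuous_FTC2 _ f F)//.
- exact: continuous_subspaceT.
- split.
  + by move=> x _; exact: (@ex_derive _ _ _ _ _ _ _ (dF x)).
  + by apply: cvg_at_right_filter; exact: is_derive1_continuous (dF a).
  + by apply: cvg_at_left_filter; exact: is_derive1_continuous (dF b).
- by move=> x _; rewrite derive1E; apply: derive_val.
Qed.

Lemma continuous_cosX n : continuous (fun t : R => cos t ^+ n).
Proof.
move=> t; apply: (@continuous_comp _ _ _ cos (fun x => x ^+ n)).
  exact: continuous_cos.
exact: exprn_continuous.
Qed.

Lemma continuous_sinX n : continuous (fun t : R => sin t ^+ n).
Proof.
move=> t; apply: (@continuous_comp _ _ _ sin (fun x => x ^+ n)).
  exact: continuous_sin.
exact: exprn_continuous.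
Qed.

Lemma pihalf_gt0 : 0 < pi / 2 :> R.
Proof. by rewrite divr_gt0// pi_gt0. Qed.

Lemma sin_cos_gt0 t : t \in `]0, pi / 2[ -> 0 < sin t /\ 0 < cos t.
Proof.
have p2 := pihalf_gt0.
rewrite in_itv/= => /andP[t0 tp]; split; first by rewrite sin_gt0_pihalf// t0.
by rewrite cos_gt0_pihalf// tp andbT (lt_trans _ t0)// oppr_lt0.
Qed.

(** The exponent 2 k is kept even so that u = sin^2 t gives
    u^(k - 1/2) (1 - u)^(1/2) du, the density of Euler's integral. *)
Definition wallis_fun k t := 2 * cos t ^+ 2 * sin t ^+ k.*2.

Lemma continuous_wallis_fun k : continuous (wallis_fun k).
Proof.
move=> t; apply: (@continuousM _ _ (fun t => 2 * cos t ^+ 2)); last first.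
  exact: continuous_sinX.
by apply: continuousM; [exact: cvg_cst|exact: continuous_cosX].
Qed.

Lemma wallis_fun0 : \int[mu]_(t in `[0, pi / 2]) wallis_fun 0 t = pi / 2.
Proof.
have dF t : is_derive t (1 : R) (fun t => t + sin t * cos t) (wallis_fun 0 t).
  apply: is_derive_eq; rewrite /wallis_fun /GRing.scale/= double0 expr0.
  by transitivity (1 + cos t ^+ 2 - sin t ^+ 2); [|rewrite sin2cos2]; ring.
rewrite (Rintegral_FTC _ (@continuous_wallis_fun 0) dF).
  by rewrite sin_pihalf cos_pihalf sin0; ring.
exact: pihalf_gt0.
Qed.

(** Integrate the derivative of 2 sin^(2k+1) t cos^3 t, which vanishes at both
    ends. *)
Lemma wallis_funS k :
  (k.*2.+4)%:R * \int[mu]_(t in `[0, pi / 2]) wallis_fun k.+1 t =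
  (k.*2.+1)%:R * \int[mu]_(t in `[0, pi / 2]) wallis_fun k t.
Proof.
have ci j := @continuous_integrable_itv _ 0 (pi / 2) (@continuous_wallis_fun j).
have p2 := pihalf_gt0.
pose f t : R := k.*2.+1%:R * wallis_fun k t - k.*2.+4%:R * wallis_fun k.+1 t.
have cw c j : continuous (fun t => c * wallis_fun j t).
  by move=> t; apply: continuousM; [exact: cvg_cst|exact: continuous_wallis_fun].
have cf : continuous f by move=> t; apply: cvgB; exact: cw.
have dF t : is_derive t (1 : R) (fun t => 2 * (sin t ^+ k.*2.+1 * cos t ^+ 3)) (f t).
  apply: is_derive_eq; rewrite /f /wallis_fun /GRing.scale/=.
  have -> : k.*2.+4%:R = k.*2.+1%:R + 3 :> R by rewrite -natrD addn3.
  have -> : sin t ^+ k.+1.*2 = sin t ^+ k.*2 * sin t ^+ 2.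
    by rewrite -exprD doubleS addn2.
  rewrite (exprSr (sin t) k.*2).
  move: (k.*2.+1%:R) (sin t ^+ k.*2) (sin2cos2 t) => a p.
  move: (sin t) (cos t) => u v uv.
  transitivity (2 * p * v ^+ 2 * (a * v ^+ 2 - 3 * u ^+ 2)); first by ring.
  rewrite uv; ring.
have := Rintegral_FTC p2 cf dF.
rewrite sin0 cos_pihalf !expr0n/= mul0r !mulr0 subr0.
rewrite RintegralB// ?RintegralZl//; last 2 first.
- exact: continuous_integrable_itv.
- exact: continuous_integrable_itv.
by move=> /eqP; rewrite subr_eq0 => /eqP.
Qed.

(** The product is (1/2)_k / (2)_k: this is the Beta integral behind Euler's
    representation. *)
Lemma integral_wallis k : \int[mu]_(t in `[0, pi / 2]) wallis_fun k t =
  pi / 2 * \prod_(i < k) ((2^-1 + i%:R) / (2 + i%:R)).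
Proof.
elim: k => [|k IH]; first by rewrite big_ord0 mulr1 wallis_fun0.
apply: (@mulfI _ k.*2.+4%:R); first by rewrite pnatr_eq0.
rewrite wallis_funS IH big_ord_recr/=.
have -> : (k.*2.+4)%:R = 2 * k%:R + 4 :> R by rewrite -mul2n -natrM -natrD addn4.
have -> : (k.*2.+1)%:R = 2 * k%:R + 1 :> R by rewrite -natr1 -mul2n natrM.
field; rewrite -natrD pnatr_eq0//.
Qed.

End Moments.

(** * The Lauricella series as a trigonometric integral *)

Section Series.
Variable R : realType.
Implicit Types (x r s t u : R) (z w : R[i]) (N : nat).
Local Notation normc := (@Normc.normc R).
Local Notation mu := (@lebesgue_measure R).

(** The product of the three inverse square roots in Euler's integral: those at z
    and at its conjugate multiply to the inverse of a modulus. *)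
Definition euler_kernel x z u : R :=
  (Num.sqrt (1 - x * u) * normc (1 - z * u%:C))^-1.

Lemma pochhammer_half n :
  pochhammer (2^-1) n / n`!%:R = half_coef R[i] n.
Proof.
elim: n => [|n IH]; first by rewrite /pochhammer /half_coef !big_ord0 divr1.
rewrite half_coefS -IH /pochhammer big_ord_recr/= factS natrM invfM.
by rewrite [RHS]mulrACA [n.+1%:R^-1 * _]mulrC.
Qed.

Lemma pochhammer_ratio n : pochhammer (2^-1) n / pochhammer 2 n =
  (2 / pi * \int[mu]_(t in `[0, pi / 2]) wallis_fun n t)%:C :> R[i].
Proof.
rewrite integral_wallis mulrA (_ : 2 / pi * (pi / 2) = 1); last first.
  have p0 : (pi : R) != 0.
    by apply: lt0r_neq0; exact: pi_gt0.
  by rewrite mulrA divfK// divff.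
rewrite mul1r rmorph_prod /pochhammer -prodf_div; apply: eq_bigr => i _.
by rewrite rmorphM/= fmorphV !rmorphD fmorphV !rmorph_nat.
Qed.

Lemma lauricellaD_termE n (X : n.-tuple R[i]) (beta : n.-tuple R[i]) (m : 'I_n -> nat) :
  (forall j, tnth beta j = 2^-1) ->
  lauricellaD_term (2^-1) beta 2 X m =
  \prod_j (half_coef R[i] (m j) * tnth X j ^+ m j) *
  (2 / pi * \int[mu]_(t in `[0, pi / 2]) wallis_fun (\sum_j m j) t)%:C.
Proof.
move=> hb; rewrite /lauricellaD_term -pochhammer_ratio.
rewrite big_split/=.
under [X in _ = X * _ * _]eq_bigr do rewrite -pochhammer_half.
rewrite prodf_div.
under [X in _ * X / _ * _ = _]eq_bigr do rewrite hb.
rewrite invfM; ring.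
Qed.

Lemma Re_sum (I : Type) (s : seq I) (P : pred I) (F : I -> R[i]) :
  complex.Re (\sum_(i <- s | P i) F i) = \sum_(i <- s | P i) complex.Re (F i).
Proof. by apply: (big_morph (@complex.Re R)) => // -[a b] [c d]. Qed.

Lemma Im_sum (I : Type) (s : seq I) (P : pred I) (F : I -> R[i]) :
  complex.Im (\sum_(i <- s | P i) F i) = \sum_(i <- s | P i) complex.Im (F i).
Proof. by apply: (big_morph (@complex.Im R)) => // -[a b] [c d]. Qed.

Lemma Re_mul_real z r : complex.Re (z * r%:C) = complex.Re z * r.
Proof. by case: z => a b /=; rewrite mulr0 subr0. Qed.

Lemma Im_mul_real z r : complex.Im (z * r%:C) = complex.Im z * r.
Proof. by case: z => a b /=; rewrite mulr0 add0r. Qed.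

Lemma continuous_sum (I : Type) (s : seq I) (F : I -> R -> R) :
  (forall i, continuous (F i)) -> continuous (fun t => \sum_(i <- s) F i t).
Proof.
move=> cF t; elim: s => [|i s IH].
  rewrite (_ : (fun t => _) = (fun=> 0)); first exact: cvg_cst.
  by apply/funext => u; rewrite big_nil.
rewrite (_ : (fun t => _) = (fun t => F i t + \sum_(j <- s) F j t)); last first.
  by apply/funext => u; rewrite big_cons.
by apply: cvgD => //; exact: cF.
Qed.

Lemma Rintegral_sum (a b : R) (I : Type) (s : seq I) (c : I -> R) (F : I -> R -> R) :
  (forall i, continuous (F i)) ->
  \int[mu]_(t in `[a, b]) (\sum_(i <- s) c i * F i t) =
  \sum_(i <- s) c i * \int[mu]_(t in `[a, b]) F i t.
Proof.
move=> cF.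
have cM i : continuous (fun t => c i * F i t).
  by move=> t; apply: cvgM; [exact: cvg_cst|exact: cF].
elim: s => [|i s IH].
  rewrite big_nil; under eq_Rintegral do rewrite big_nil.
  by rewrite Rintegral_cst// mul0r.
under eq_Rintegral do rewrite big_cons.
rewrite RintegralD//=; last 2 first.
- exact: continuous_integrable_itv.
- by apply: continuous_integrable_itv; exact: continuous_sum.
by rewrite IH big_cons RintegralZl//; exact: continuous_integrable_itv.
Qed.

Lemma cintegral_sum (a b : R) (I : Type) (s : seq I) (c : I -> R[i]) (F : I -> R -> R) :
  (forall i, continuous (F i)) ->
  cintegral `[a, b] (fun t => \sum_(i <- s) c i * (F i t)%:C) =
  \sum_(i <- s) c i * (\int[mu]_(t in `[a, b]) F i t)%:C.
Proof.
move=> cF; rewrite /cintegral [RHS]complexE.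
rewrite Re_sum Im_sum.
under eq_Rintegral => t _ do (rewrite Re_sum; under eq_bigr do rewrite Re_mul_real).
rewrite Rintegral_sum//.
under [X in _ +i* X]eq_Rintegral => t _ do (rewrite Im_sum; under eq_bigr do rewrite Im_mul_real).
rewrite Rintegral_sum//.
under [X in _ = X%:C + _]eq_bigr do rewrite Re_mul_real.
under [X in _ = _ + _ * X%:C]eq_bigr do rewrite Im_mul_real.
by simpc.
Qed.

Definition half_tuple : 3.-tuple R[i] := [tuple 2^-1; 2^-1; 2^-1].

Definition real_conj_tuple x z : 3.-tuple R[i] := [tuple x%:C; z; conjc z].

Lemma prod_tuple3 (A : Type) (F : A -> R[i]) (a b c : A) :
  \prod_(j < 3) F (tnth [tuple a; b; c] j) = F a * F b * F c.
Proof.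
by rewrite !big_ord_recl big_ord0 mulr1 mulrA !(tnth_nth a)/=.
Qed.

(** What a box sum becomes under the integral sign: three truncated binomial
    series, two of which are conjugate. *)
Definition box_integrand x z N t : R :=
  2 * cos t ^+ 2 * ((half_poly R N).[x * sin t ^+ 2] *
    normc (half_poly R[i] N).[z * (sin t ^+ 2)%:C] ^+ 2).

(** The power sin^(2 (m_0 + m_1 + m_2)) t splits over the three indices, so the
    sum over the box is a product of three sums. *)
Lemma box_integrandE x z N t :
  \sum_(m : {ffun 'I_3 -> 'I_N})
    (\prod_j (half_coef R[i] (m j) * tnth (real_conj_tuple x z) j ^+ m j)) *
    (wallis_fun (\sum_j m j) t)%:C = (box_integrand x z N t)%:C.
Proof.
pose u := (sin t ^+ 2)%:C.
transitivity ((2 * cos t ^+ 2)%:C *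
    \prod_j (half_poly R[i] N).[tnth (real_conj_tuple x z) j * u]).
  under [in RHS]eq_bigr do rewrite horner_poly.
  rewrite bigA_distr_bigA mulr_sumr; apply: eq_bigr => m _ /=.
  rewrite /wallis_fun rmorphM/= mulrCA; congr (_ * _).
  rewrite -mul2n big_distrr/= -prodrXr rmorph_prod -big_split/=.
  apply: eq_bigr => j _.
  by rewrite exprMn -mulrA; congr (_ * (_ * _)); rewrite /u -rmorphXn -exprM.
rewrite (prod_tuple3 (fun y => (half_poly R[i] N).[y * u])).
have -> : conjc z * u = conjc (z * u) by rewrite /u; case: z => c d; simpc.
rewrite half_poly_conj -mulrA mul_conjc.
by rewrite -[x%:C * u]rmorphM half_poly_real -!rmorphM.
Qed.

Lemma box_sumE x z N :
  \sum_(m : {ffun 'I_3 -> 'I_N})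
    lauricellaD_term (2^-1) half_tuple 2 (real_conj_tuple x z) (fun j => m j) =
  (2 / pi * \int[mu]_(t in `[0, pi / 2]) box_integrand x z N t)%:C.
Proof.
under eq_bigr => m _.
  rewrite lauricellaD_termE; last first.
    by case=> -[|[|[|//]]] h; rewrite (tnth_nth 0).
  rewrite rmorphM/= mulrCA.
  over.
rewrite -mulr_sumr -cintegral_sum; last by move=> i; exact: continuous_wallis_fun.
rewrite [RHS]rmorphM; congr (_ * _).
rewrite /cintegral.
under eq_Rintegral do rewrite box_integrandE.
under [X in _ +i* X]eq_Rintegral do rewrite box_integrandE.
by rewrite Rintegral_cst// mul0r.
Qed.

Lemma continuous_box_integrand x z N : continuous (box_integrand x z N).
Proof.
rewrite (_ : box_integrand x z N = fun t => \sum_(m : {ffun 'I_3 -> 'I_N})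
  complex.Re (\prod_j (half_coef R[i] (m j) * tnth (real_conj_tuple x z) j ^+ m j)) *
    wallis_fun (\sum_j m j) t).
  apply: continuous_sum => m t; apply: cvgM; first exact: cvg_cst.
  exact: continuous_wallis_fun.
apply/funext => t; rewrite -[LHS]/(complex.Re (box_integrand x z N t)%:C).
by rewrite -box_integrandE Re_sum; apply: eq_bigr => m _; rewrite Re_mul_real.
Qed.

End Series.

Section SeriesLimit.
Variable R : realType.
Implicit Types (x r s t u : R) (z w : R[i]) (N : nat).
Local Notation normc := (@Normc.normc R).
Local Notation mu := (@lebesgue_measure R).

Lemma lim_real_complex (r_ : nat -> R) r : r_ N @[N --> \oo] --> r ->
  limn (fun N => (r_ N)%:C : R[i]^o) = r%:C.
Proof.
move=> cr; apply: cvg_lim; first exact: norm_hausdorff.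
apply/cvgrPdist_lt => e e0.
have := e0; rewrite ltcE => /andP[/eqP/= e1 e2].
have /cvgrPdist_lt/(_ _ e2) := cr.
apply: filterS => N h.
rewrite -rmorphB normcE normc_real.
by rewrite (_ : e = (complex.Re e)%:C) ?ltcR// [LHS]complexE e1 mulr0 addr0.
Qed.

Lemma sin2_itv t : 0 <= sin t ^+ 2 <= 1.
Proof. by rewrite sqr_ge0/= -(cos2Dsin2 t) lerDr sqr_ge0. Qed.

Lemma cos2_le1 t : cos t ^+ 2 <= 1.
Proof. by rewrite -(cos2Dsin2 t) lerDl sqr_ge0. Qed.

Lemma euler_kernel_continuous x z u : 0 < 1 - x * u -> 1 - z * u%:C != 0 ->
  {for u, continuous (euler_kernel x z)}.
Proof.
move=> hx hz.
have cl (c : R) : {for u, continuous (fun v => c * v)}.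
  by apply: cvgM; [exact: cvg_cst|exact: cvg_id].
have ca (c : R) : {for u, continuous (fun v => 1 - c * v)}.
  by apply: cvgB; [exact: cvg_cst|exact: cl].
pose p := complex.Re z; pose q := complex.Im z.
pose g v := Num.sqrt ((1 - p * v) * (1 - p * v) + (q * v) * (q * v)).
have E v : normc (1 - z * v%:C) = g v.
  rewrite /g /p /q; case: (z) => a b.
  by rewrite /= -!expr2; congr (Num.sqrt _); ring.
have cg : {for u, continuous g}.
  apply: continuous_cvg; first exact: sqrt_continuous.
  by apply: cvgD; apply: cvgM; [exact: ca|exact: ca|exact: cl|exact: cl].
apply: cvgV.
  rewrite mulf_neq0//; first by rewrite gt_eqF// sqrtr_gt0.
  by apply/eqP => /Normc.eq0_normc/eqP; apply/negP; rewrite hz.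
apply: cvgM; first by apply: continuous_cvg; [exact: sqrt_continuous|exact: ca].
by rewrite E (_ : (fun v => normc _) = g) //; apply/funext => v; exact: E.
Qed.

Lemma continuous_euler_kernel x z :
    (forall u, 0 <= u <= 1 -> 0 < 1 - x * u) ->
    (forall u, 0 <= u <= 1 -> 1 - z * u%:C != 0) ->
  continuous (fun t => 2 * cos t ^+ 2 * euler_kernel x z (sin t ^+ 2)).
Proof.
move=> hx hz t; apply: cvgM.
  by apply: cvgM; [exact: cvg_cst|exact: continuous_cosX].
apply: continuous_cvg; last exact: continuous_sinX.
by apply: euler_kernel_continuous; [exact/hx/sin2_itv|exact/hz/sin2_itv].
Qed.

Lemma box_integrand_cvg x z t : `|x| < 1 -> normc z < 1 ->
  box_integrand x z N t @[N --> \oo] -->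
  2 * cos t ^+ 2 * euler_kernel x z (sin t ^+ 2).
Proof.
move=> x1 z1; have /andP[s0 s1] := sin2_itv t.
rewrite /box_integrand /euler_kernel invfM.
apply: cvgM; first exact: cvg_cst.
apply: cvgM.
  apply: half_poly_cvg; rewrite normrM (ger0_norm s0).
  by rewrite (le_lt_trans _ x1)// ler_piMr.
apply: half_poly_normc_cvg.
rewrite Normc.normcM normc_real (ger0_norm s0).
by rewrite (le_lt_trans _ z1)// ler_piMr// normc_ge0.
Qed.

Lemma box_integrand_le x z t N : `|x| < 1 -> normc z < 1 ->
  `|box_integrand x z N t| <= 2 * ((1 - `|x|)^-1 * (1 - normc z)^-1 ^+ 2).
Proof.
move=> x1 z1; have /andP[s0 s1] := sin2_itv t.
have xs : `|x * sin t ^+ 2| <= `|x| by rewrite normrM (ger0_norm s0) ler_piMr.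
have zs : normc (z * (sin t ^+ 2)%:C) <= normc z.
  by rewrite Normc.normcM normc_real (ger0_norm s0) ler_piMr// normc_ge0.
have xs1 := le_lt_trans xs x1; have zs1 := le_lt_trans zs z1.
have hP : `|(half_poly R N).[x * sin t ^+ 2]| <= (1 - `|x|)^-1.
  have := half_poly_normc_le N (z := (x * sin t ^+ 2)%:C).
  rewrite half_poly_real !normc_real => /(_ xs1) /le_trans; apply.
  by rewrite lef_pV2 ?posrE ?subr_gt0// lerD2l lerN2.
have hQ : normc (half_poly R[i] N).[z * (sin t ^+ 2)%:C] ^+ 2 <= (1 - normc z)^-1 ^+ 2.
  rewrite ler_pXn2r ?nnegrE ?invr_ge0 ?subr_ge0 ?(ltW z1) ?normc_ge0//.
  rewrite (le_trans (half_poly_normc_le N zs1))//.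
  by rewrite lef_pV2 ?posrE ?subr_gt0// lerD2l lerN2.
rewrite /box_integrand -mulrA normrM (ger0_norm (ler0n _ _)) ler_pM2l//.
rewrite normrM (ger0_norm (sqr_ge0 _)) -[leRHS]mul1r.
apply: ler_pM; rewrite ?sqr_ge0 ?normr_ge0 ?cos2_le1//.
rewrite normrM [X in _ * X]ger0_norm ?sqr_ge0//.
by apply: ler_pM; rewrite ?normr_ge0 ?sqr_ge0.
Qed.

Lemma one_sub_mul_gt0 x u : x < 1 -> 0 <= u <= 1 -> 0 < 1 - x * u.
Proof.
move=> x1 /andP[u0 u1]; rewrite subr_gt0; have [x0|/ltW x0] := leP x 0.
  exact: le_lt_trans (mulr_le0_ge0 x0 u0) _.
by rewrite (le_lt_trans _ x1)// ler_piMr.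
Qed.

Lemma one_sub_mul_neq0 z u : complex.Re z < 1 -> 0 <= u <= 1 ->
  1 - z * u%:C != 0.
Proof.
move=> z1 u01; apply/negP; rewrite eq_complex => /andP[/eqP + _].
case: z z1 => p q /= p1; rewrite mulr0 subr0 => h.
by have := one_sub_mul_gt0 p1 u01; rewrite h ltxx.
Qed.

Lemma Re_lt1 z : normc z < 1 -> complex.Re z < 1.
Proof.
case: z => p q /=; apply: le_lt_trans; rewrite (le_trans (ler_norm _))//.
by rewrite -sqrtr_sqr ler_wsqrtr// lerDl sqr_ge0.
Qed.

Lemma integral_box_cvg x z : `|x| < 1 -> normc z < 1 ->
  \int[mu]_(t in `[0, pi / 2]) box_integrand x z N t @[N --> \oo] -->
  \int[mu]_(t in `[0, pi / 2]) (2 * cos t ^+ 2 * euler_kernel x z (sin t ^+ 2)).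
Proof.
move=> x1 z1.
set f := fun t => 2 * cos t ^+ 2 * euler_kernel x z (sin t ^+ 2).
have cf : continuous f.
  apply: continuous_euler_kernel => u u01.
    by apply: one_sub_mul_gt0 => //; case/ltr_normlP: x1.
  by apply: one_sub_mul_neq0 => //; exact: Re_lt1.
have If := @continuous_integrable_itv _ f 0 (pi / 2) cf.
apply: fine_cvg.
rewrite /Rintegral fineK; last exact: integrable_fin_num.
apply: (@dominated_cvg _ _ _ mu _ _ (fun N t => (box_integrand x z N t)%:E)
  (EFin \o f) (cst (2 * ((1 - `|x|)^-1 * (1 - normc z)^-1 ^+ 2))%:E)) => //.
- move=> N; apply/measurable_EFinP; apply: measurable_funTS.
  by apply: continuous_measurable_fun; exact: continuous_box_integrand.
- by move=> t _; apply: cvg_EFin; [exact: nearW|exact: box_integrand_cvg].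
- by apply: continuous_integrable_itv => t; exact: cvg_cst.
- by move=> N t _; rewrite lee_fin box_integrand_le.
Qed.

Lemma lauricellaD_seriesE x z : `|x| < 1 -> normc z < 1 ->
  lauricellaD_series (2^-1) (half_tuple R) 2 (real_conj_tuple x z) =
  (2 / pi * \int[mu]_(t in `[0, pi / 2])
      (2 * cos t ^+ 2 * euler_kernel x z (sin t ^+ 2)))%:C.
Proof.
move=> x1 z1; rewrite /lauricellaD_series.
under eq_fun do rewrite box_sumE.
apply: lim_real_complex.
by apply: cvgM; [exact: cvg_cst|exact: integral_box_cvg].
Qed.

End SeriesLimit.

(** * Euler's integral as a trigonometric integral *)

Section EulerIntegral.
Variable R : realType.
Implicit Types (x r s t u : R) (z w : R[i]) (N : nat).
Local Notation normc := (@Normc.normc R).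
Local Notation mu := (@lebesgue_measure R).

Lemma half_real : 2^-1 = (2^-1 : R)%:C :> R[i].
Proof. by rewrite fmorphV rmorph_nat. Qed.

(** The hypothesis keeps w off the cut, where the principal argument of a real
    negative number is pi on both sides. *)
Lemma carg_conj w : 0 < complex.Re w -> carg (conjc w) = - carg w.
Proof.
move=> hw; have [w0|w0] := eqVneq (complex.Im w) 0.
  have wE : w = (complex.Re w)%:C by rewrite [LHS]complexE w0 mulr0 addr0.
  by rewrite wE conjc_real carg_gt0// oppr0.
rewrite /carg normc_conj; case: w w0 {hw} => p q /= q0.
by rewrite oppr_ge0; case: ltgtP q0 => //; rewrite ?opprK.
Qed.

Lemma cpow_half_conj w : 0 < complex.Re w ->
  cpow w (2^-1) * cpow (conjc w) (2^-1) = (normc w)%:C.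
Proof.
move=> hw.
have n0 : 0 < normc w.
  rewrite lt0r normc_ge0 andbT; apply/eqP => /Normc.eq0_normc w0.
  by move: hw; rewrite w0/= ltxx.
rewrite /cpow /clog normc_conj carg_conj// half_real /cexp /=.
rewrite !mul0r subr0 !addr0 mulrN cosN sinN.
set e := expR _; set c := cos _; set s := sin _.
have e2 : e * e = normc w.
  rewrite /e -expRD (_ : _ + _ = ln (normc w)); last by field.
  by rewrite lnK// posrE.
have cs : c ^+ 2 + s ^+ 2 = 1 by exact: cos2Dsin2.
simpc; congr (_ +i* _); last by ring.
by rewrite -e2 -[RHS]mulr1 -cs; ring.
Qed.

Lemma euler_integrandE x z u :
    x < 1 -> complex.Re z < 1 -> 0 < u < 1 ->
  cpow u%:C (2^-1 - 1) * cpow (1 - u%:C) (2 - 2^-1 - 1) /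
    (\prod_j cpow (1 - tnth (real_conj_tuple x z) j * u%:C) (tnth (half_tuple R) j)) =
  ((Num.sqrt u)^-1 * Num.sqrt (1 - u) * euler_kernel x z u)%:C.
Proof.
move=> x1 hz /andP[u0 u1].
have u01 : 0 <= u <= 1 by rewrite !ltW.
have xu := one_sub_mul_gt0 x1 u01.
have xu1 : x * u < 1 by rewrite -subr_gt0.
rewrite !big_ord_recl big_ord0 mulr1 !(tnth_nth 0)/=.
rewrite (_ : 1 - conjc z * u%:C = conjc (1 - z * u%:C)); last first.
  case: z {hz} => p q; apply/eqP; rewrite eq_complex/=.
  by apply/andP; split; apply/eqP; ring.
rewrite (@cpow_half_conj (1 - z * u%:C)); last first.
  by case: z hz => p q /= p1; rewrite mulr0 subr0; exact: one_sub_mul_gt0.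
have -> : 1 - x%:C * u%:C = (1 - x * u)%:C by rewrite rmorphB rmorphM rmorph1.
have -> : 1 - u%:C = (1 - u)%:C by rewrite rmorphB rmorph1.
have -> : 2 - 2^-1 - 1 = (2^-1 : R)%:C.
  by rewrite fmorphV rmorph_nat; field.
have -> : 2^-1 - 1 = (- 2^-1 : R)%:C.
  by rewrite rmorphN fmorphV rmorph_nat; field.
rewrite half_real !cpow_gt0 ?subr_gt0//.
rewrite powRN !powR12_sqrt ?ltW ?subr_gt0//.
by rewrite -!rmorphM -fmorphV -rmorphM.
Qed.

(** The substitution u = sin^2 t absorbs both u^(-1/2) and (1 - u)^(1/2). *)
Lemma integral_sin2_subst x z :
    x < 1 -> complex.Re z < 1 ->
  \int[mu]_(u in `]0, 1[) ((Num.sqrt u)^-1 * Num.sqrt (1 - u) * euler_kernel x z u) =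
  \int[mu]_(t in `[0, pi / 2]) (2 * cos t ^+ 2 * euler_kernel x z (sin t ^+ 2)).
Proof.
move=> x1 hz.
set G := fun u => (Num.sqrt u)^-1 * Num.sqrt (1 - u) * euler_kernel x z u.
pose F t : R := sin t ^+ 2; pose dF t : R := 2 * sin t * cos t.
have F0 : F 0 = 0 by rewrite /F sin0 expr0n.
have F1 : F (pi / 2) = 1 by rewrite /F sin_pihalf expr1n.
have p2 := pihalf_gt0 R.
have cF : continuous F by exact: continuous_sinX.
have dFE t : is_derive t (1 : R) F (dF t).
  by rewrite /F /dF; apply: is_derive_eq; rewrite /= expr1.
have cdF : continuous dF.
  move=> t; apply: cvgM; last exact: continuous_cos.
  by apply: cvgM; [exact: cvg_cst|exact: continuous_sin].
have cf : continuous (fun t => 2 * cos t ^+ 2 * euler_kernel x z (sin t ^+ 2)).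
  apply: continuous_euler_kernel => u u01; first exact: one_sub_mul_gt0.
  exact: one_sub_mul_neq0.
have k0 u : 0 <= euler_kernel x z u.
  by rewrite invr_ge0 mulr_ge0 ?sqrtr_ge0 ?normc_ge0.
rewrite /Rintegral; congr fine.
have := @ge0_integral_subst_oo R F dF G 0 (pi / 2) p2 (cF _) (cF _).
rewrite F0 F1 => ->.
- rewrite [RHS]integral_itv_bndoo; last first.
    apply/measurable_EFinP; apply: measurable_funTS.
    exact: (continuous_measurable_fun cf).
  apply: eq_integral => t; rewrite inE => /sin_cos_gt0[s0 c0].
  congr EFin; rewrite /G /F /dF.
  rewrite -cos2sin2 !sqrtr_sqr !gtr0_norm//; field; exact: lt0r_neq0.
- by move=> t _; exact: dFE.
- by move=> t _; exact: cdF.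
- by move=> t /sin_cos_gt0[s0 c0]; rewrite /dF !mulr_gt0.
- move=> u; rewrite in_itv/= => /andP[u0 u1].
  have u01 : 0 <= u <= 1 by rewrite !ltW.
  apply: cvgM; last first.
    by apply: euler_kernel_continuous; [exact: one_sub_mul_gt0|exact: one_sub_mul_neq0].
  apply: cvgM.
    apply: cvgV; first by rewrite gt_eqF// sqrtr_gt0.
    exact: sqrt_continuous.
  apply: continuous_cvg; first exact: sqrt_continuous.
  by apply: cvgB; [exact: cvg_cst|exact: cvg_id].
- by move=> u _; apply: mulr_ge0 => //; apply: mulr_ge0; rewrite ?invr_ge0 sqrtr_ge0.
Qed.

Lemma lauricellaD_integralE x z :
    x < 1 -> complex.Re z < 1 ->
  lauricellaD_integral (2^-1) (half_tuple R) 2 (real_conj_tuple x z) =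
  (2 / pi * \int[mu]_(t in `[0, pi / 2])
      (2 * cos t ^+ 2 * euler_kernel x z (sin t ^+ 2)))%:C.
Proof.
move=> x1 hz; rewrite /lauricellaD_integral cGamma2 cGamma_half cGamma_three_half.
rewrite [RHS]rmorphM -integral_sin2_subst//.
have -> : 1 / ((Num.sqrt pi)%:C * (Num.sqrt pi / 2)%:C) = (2 / pi : R)%:C :> R[i].
  by rewrite -rmorphM div1r -fmorphV/= mulrA -expr2 sqr_sqrtr ?pi_ge0// invf_div.
congr (_ * _).
have E u : u \in `]0, 1[%classic -> _ := fun u01 => euler_integrandE x1 hz (set_mem u01).
rewrite /cintegral; congr (_ +i* _).
  by apply: eq_Rintegral => u /E ->.
rewrite (@eq_Rintegral _ _ _ mu _ (fun=> 0)) ?Rintegral_cst ?mul0r//.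
by move=> u /E ->.
Qed.

End EulerIntegral.

(** * Complete elliptic integrals in a common variable *)

Section Elliptic.
Variable R : realType.
Implicit Types (x r s t u k : R) (z w : R[i]) (N : nat).
Local Notation normc := (@Normc.normc R).
Local Notation mu := (@lebesgue_measure R).

(** Any increasing F from [0, pi/2] onto [0, 1] may replace x, provided the
    transformed integrand extends to a continuous f: the singularity at x = 1
    is then compensated by the zero of dF. *)
Lemma ellipticK_subst k (F dF f : R -> R) : k ^+ 2 < 1 ->
    continuous F -> F 0 = 0 -> F (pi / 2) = 1 ->
    {in `]0, pi / 2[, forall t, is_derive t (1 : R) F (dF t)} ->
    {in `]0, pi / 2[, forall t, {for t, continuous dF}} ->
    {in `]0, pi / 2[, forall t, 0 < dF t} ->
    continuous f ->
    {in `]0, pi / 2[, forall t,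
      (Num.sqrt ((1 - F t ^+ 2) * (1 - k ^+ 2 * F t ^+ 2)))^-1 * dF t = f t} ->
  ellipticK k = \int[mu]_(t in `[0, pi / 2]) f t.
Proof.
move=> k1 cF F0 F1 dFE cdF dF0 cf fE.
pose G x := (Num.sqrt ((1 - x ^+ 2) * (1 - k ^+ 2 * x ^+ 2)))^-1.
have p2 := pihalf_gt0 R.
have cG x : x \in `]0, 1[ -> {for x, continuous G}.
  rewrite in_itv/= => /andP[x0 x1].
  have x2 : x ^+ 2 < 1 by rewrite expr_lt1// ltW.
  have c1 (c : R) : {for x, continuous (fun x => 1 - c * x ^+ 2)}.
    apply: cvgB; first exact: cvg_cst.
    by apply: cvgM; [exact: cvg_cst|exact: exprn_continuous].
  apply: cvgV.
    rewrite gt_eqF// sqrtr_gt0 mulr_gt0 ?subr_gt0//.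
    by rewrite (le_lt_trans _ x2)// ler_piMl ?sqr_ge0// ltW.
  apply: continuous_cvg; first exact: sqrt_continuous.
  apply: cvgM; last exact: c1.
  by apply: cvgB; [exact: cvg_cst|exact: exprn_continuous].
rewrite /ellipticK /Rintegral; congr fine.
rewrite (@integral_itv_bndoo _ _ _ (fun x => (G x)%:E)); last first.
  apply/measurable_EFinP; apply: open_continuous_measurable_fun.
    exact: interval_open.
  by move=> x /set_mem; exact: cG.
have := @ge0_integral_subst_oo R F dF G 0 (pi / 2) p2 (cF _) (cF _).
rewrite F0 F1 => ->//.
- rewrite [RHS]integral_itv_bndoo; last first.
    apply/measurable_EFinP; apply: measurable_funTS.
    exact: (continuous_measurable_fun cf).
  by apply: eq_integral => t; rewrite inE => /fE <-.
- by move=> u _; rewrite /G invr_ge0 sqrtr_ge0.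
Qed.

Lemma Rintegral_flip f : continuous f ->
  \int[mu]_(t in `[0, pi / 2]) f (pi / 2 - t) = \int[mu]_(t in `[0, pi / 2]) f t.
Proof.
move=> cf.
have p2 := pihalf_gt0 R.
pose F t : R := pi / 2 - t.
have dF t : is_derive t (1 : R) F (- 1).
  by rewrite /F; apply: is_derive_eq; rewrite /GRing.scale/=; ring.
have F'E : F^`()%classic = (fun=> - 1).
  by apply/funext => t; rewrite derive1E; apply: derive_val.
have := @integration_by_substitution_decreasing _ F f 0 (pi / 2) (ltW p2).
rewrite /F subrr subr0 -/F F'E => h.
rewrite /Rintegral; congr fine; rewrite h.
- by apply: eq_integral => t _; rewrite !fctE opprK mulr1.
- by move=> x y _ _ xy; rewrite ltrD2l ltrN2.
- by move=> t _; exact: cvg_cst.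
- by apply/cvg_ex; exists (- 1); exact: cvg_cst.
- by apply/cvg_ex; exists (- 1); exact: cvg_cst.
- split.
  + by move=> t _; exact: (@ex_derive _ _ _ _ _ _ _ (dF t)).
  + by apply: cvg_at_right_filter; exact: is_derive1_continuous (dF 0).
  + by apply: cvg_at_left_filter; exact: is_derive1_continuous (dF (pi / 2)).
- exact: continuous_subspaceT.
Qed.

End Elliptic.

Section RadicalIntegrals.
Variable R : realType.
Variables a b : R.
Hypothesis b1 : 1 < b.
Implicit Types r t u : R.
Local Notation mu := (@lebesgue_measure R).

Definition quartic r : R := b ^+ 4 - 2 * b ^+ 2 * cos (2 * a) * r ^+ 2 + r ^+ 4.

(** The radical common to both elliptic integrals and to Euler's integral. *)
Definition radical t : R :=
  Num.sqrt (quartic (sin t)) * Num.sqrt (b ^+ 4 - sin t ^+ 2).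

(** This form shows positivity, and it is also the identity that makes 1 - k^2 x^2
    a square in the first elliptic integral. *)
Lemma quarticE r : quartic r = (b ^+ 2 - r ^+ 2) ^+ 2 + 4 * b ^+ 2 * sin a ^+ 2 * r ^+ 2.
Proof. by rewrite /quartic (mulr_natl a 2) cos_mulr2n cos2sin2 mulr2n; ring. Qed.

Lemma b2_gt1 : 1 < b ^+ 2.
Proof. by rewrite expr_gt1// ltW// (lt_trans ltr01). Qed.

Lemma b4_gt1 : 1 < b ^+ 4.
Proof. by rewrite expr_gt1// ltW// (lt_trans ltr01). Qed.

Lemma quartic_gt0 r : r ^+ 2 <= 1 -> 0 < quartic r.
Proof.
move=> r1; rewrite quarticE ltr_pwDl//.
  by rewrite exprn_gt0// subr_gt0 (le_lt_trans r1)// b2_gt1.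
by rewrite mulr_ge0 ?sqr_ge0// mulr_ge0 ?sqr_ge0// mulr_ge0 ?sqr_ge0.
Qed.

Lemma sin2_le1 t : sin t ^+ 2 <= 1.
Proof. by have /andP[] := sin2_itv t. Qed.

Lemma b4_sub_sin2_gt0 t : 0 < b ^+ 4 - sin t ^+ 2.
Proof. by rewrite subr_gt0 (le_lt_trans (sin2_le1 t)) ?b4_gt1. Qed.

Lemma b2_sub_sin2_gt0 t : 0 < b ^+ 2 - sin t ^+ 2.
Proof. by rewrite subr_gt0 (le_lt_trans (sin2_le1 t)) ?b2_gt1. Qed.

Lemma radical_gt0 t : 0 < radical t.
Proof.
by rewrite mulr_gt0// sqrtr_gt0; [rewrite quartic_gt0 ?sin2_le1|exact: b4_sub_sin2_gt0].
Qed.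

Lemma continuous_quartic_sin : continuous (fun t => quartic (sin t)).
Proof.
move=> t; apply: cvgD; last exact: continuous_sinX.
apply: cvgB; first exact: cvg_cst.
by apply: cvgM; [exact: cvg_cst|exact: continuous_sinX].
Qed.

Lemma continuous_radical : continuous radical.
Proof.
move=> t; apply: cvgM; (apply: continuous_cvg; first exact: sqrt_continuous).
  exact: continuous_quartic_sin.
by apply: cvgB; [exact: cvg_cst|exact: continuous_sinX].
Qed.

Lemma continuous_div_radical (f : R -> R) : continuous f ->
  continuous (fun t => f t / radical t).
Proof.
move=> cf t; apply: cvgM; first exact: cf.
by apply: cvgV; [exact/lt0r_neq0/radical_gt0|exact: continuous_radical].
Qed.

(** This is the modulus of b^2 - e^(2 i a), and also of 1 - b^2 e^(- 2 i a). *)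
Definition dist : R := Num.sqrt (1 - 2 * b ^+ 2 * cos (2 * a) + b ^+ 4).

Lemma sqr_dist : dist ^+ 2 = quartic 1.
Proof.
have E : 1 - 2 * b ^+ 2 * cos (2 * a) + b ^+ 4 = quartic 1.
  by rewrite /quartic; ring.
by rewrite /dist sqr_sqrtr E// ltW// quartic_gt0// expr1n.
Qed.

Lemma dist_gt0 : 0 < dist.
Proof.
rewrite lt0r sqrtr_ge0 andbT -[dist == 0](@expf_eq0 _ _ 2) sqr_dist gt_eqF//.
by rewrite quartic_gt0 ?expr1n.
Qed.

Lemma modulus1_lt1 : (2 * b * sin a / dist) ^+ 2 < 1.
Proof.
rewrite exprMn exprVn ltr_pdivrMr ?exprn_gt0 ?dist_gt0// mul1r sqr_dist quarticE.
rewrite [ltLHS](_ : _ = 4 * b ^+ 2 * sin a ^+ 2 * 1 ^+ 2); last by ring.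
by rewrite ltrDr exprn_gt0// expr1n subr_gt0 b2_gt1.
Qed.

Lemma modulus2_lt1 : (2 * b * cos a / (1 + b ^+ 2)) ^+ 2 < 1.
Proof.
have h : 0 < 1 + b ^+ 2 by rewrite ltr_pwDl// sqr_ge0.
rewrite exprMn exprVn ltr_pdivrMr ?exprn_gt0// mul1r -subr_gt0.
have -> : (1 + b ^+ 2) ^+ 2 - (2 * b * cos a) ^+ 2 = quartic 1.
  by rewrite quarticE sin2cos2; ring.
by rewrite quartic_gt0 ?expr1n.
Qed.

(** Substitution x = D r / sqrt P(r) with r = sin t, where D is [dist] and P is
    [quartic]. *)
Lemma ellipticK1 : ellipticK (2 * b * sin a / dist) / dist =
  \int[mu]_(t in `[0, pi / 2]) ((b ^+ 2 + sin t ^+ 2) / radical t).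
Proof.
have D0 := dist_gt0; have Dn0 := lt0r_neq0 D0.
pose S t := Num.sqrt (quartic (sin t)).
have Sgt0 t : 0 < S t by rewrite sqrtr_gt0 quartic_gt0 ?sin2_le1.
have S2 t : S t ^+ 2 = quartic (sin t) by rewrite sqr_sqrtr// ltW// quartic_gt0 ?sin2_le1.
pose f t := dist * ((b ^+ 2 + sin t ^+ 2) / radical t).
pose F t := dist * sin t * (S t)^-1.
pose dF t := dist * (b ^+ 4 - sin t ^+ 4) * cos t * (S t ^+ 3)^-1.
have cg : continuous (fun t => (b ^+ 2 + sin t ^+ 2) / radical t).
  apply: continuous_div_radical => t.
  by apply: cvgD; [exact: cvg_cst|exact: continuous_sinX].
have cf : continuous f by move=> t; apply: cvgM; [exact: cvg_cst|exact: cg].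
have cS : continuous S.
  move=> t; apply: continuous_cvg; first exact: sqrt_continuous.
  exact: continuous_quartic_sin.
have cS3 : continuous (fun t => S t ^+ 3).
  move=> t; apply: (@continuous_comp _ _ _ S (fun x => x ^+ 3)); first exact: cS.
  exact: exprn_continuous.
have dFE t : is_derive t (1 : R) F (dF t).
  pose P1 := (- 4 * b ^+ 2 * cos (2 * a) * sin t + 4 * sin t ^+ 3) * cos t.
  have dP : is_derive t (1 : R) (fun t => quartic (sin t)) P1.
    rewrite /quartic; apply: is_derive_eq.
    by rewrite /P1 /GRing.scale/=; ring.
  have dS : is_derive t (1 : R) S ((2 * S t)^-1 * P1).
    exact: (@is_derive1_comp R Num.sqrt (fun t => quartic (sin t)) t _ _
      (is_derive1_sqrt (quartic_gt0 (sin2_le1 t))) dP).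
  have dV := is_deriveV (lt0r_neq0 (Sgt0 t)) dS.
  rewrite /F; apply: is_derive_eq.
  rewrite /dF.
  have -> : b ^+ 4 - sin t ^+ 4 = S t ^+ 2 - sin t * (- 2 * b ^+ 2 * cos (2 * a) * sin t + 2 * sin t ^+ 3).
    by rewrite S2 /quartic; ring.
  rewrite /P1 /GRing.scale/=; field; exact: lt0r_neq0.
have fE t : t \in `]0, pi / 2[ ->
  (Num.sqrt ((1 - F t ^+ 2) * (1 - (2 * b * sin a / dist) ^+ 2 * F t ^+ 2)))^-1 * dF t = f t.
  move=> /sin_cos_gt0[s0 c0].
  pose T := Num.sqrt (b ^+ 4 - sin t ^+ 2).
  have T0 : 0 < T by rewrite sqrtr_gt0 b4_sub_sin2_gt0.
  have T2 : T ^+ 2 = b ^+ 4 - sin t ^+ 2 by rewrite sqr_sqrtr// ltW// b4_sub_sin2_gt0.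
  have br := b2_sub_sin2_gt0 t.
  have S0 := Sgt0 t.
  have Sn0 := lt0r_neq0 S0.
  have e1 : 1 - F t ^+ 2 = (cos t * T / S t) ^+ 2.
    have -> : 1 - F t ^+ 2 = (S t ^+ 2 - dist ^+ 2 * sin t ^+ 2) / S t ^+ 2.
      by rewrite /F; field.
    rewrite !exprMn exprVn T2 cos2sin2 S2 sqr_dist /quartic; congr (_ / _); ring.
  have e2 : 1 - (2 * b * sin a / dist) ^+ 2 * F t ^+ 2 = ((b ^+ 2 - sin t ^+ 2) / S t) ^+ 2.
    have -> : 1 - (2 * b * sin a / dist) ^+ 2 * F t ^+ 2 =
        (S t ^+ 2 - 4 * b ^+ 2 * sin a ^+ 2 * sin t ^+ 2) / S t ^+ 2.
      by rewrite /F; field; rewrite Dn0 Sn0.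
    by rewrite expr_div_n S2 quarticE addrK.
  rewrite e1 e2 -exprMn sqrtr_sqr gtr0_norm; last first.
    by rewrite !mulr_gt0 ?invr_gt0.
  rewrite /dF /f /radical -/(S t) -/T.
  field; rewrite Sn0 (lt0r_neq0 T0) (lt0r_neq0 c0) (lt0r_neq0 br)//.
suff -> : ellipticK (2 * b * sin a / dist) = \int[mu]_(t in `[0, pi / 2]) f t.
  by rewrite /f RintegralZl//; [rewrite mulrC mulKf|exact: continuous_integrable_itv].
apply: (@ellipticK_subst _ _ F dF f modulus1_lt1) => //.
- move=> t; apply: cvgM; last by apply: cvgV; [exact: lt0r_neq0|exact: cS].
  by apply: cvgM; [exact: cvg_cst|exact: continuous_sin].
- by rewrite /F sin0 mulr0 mul0r.
- rewrite /F /S sin_pihalf mulr1 -sqr_dist sqrtr_sqr gtr0_norm// divff//.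
- move=> t _; apply: cvgM.
    apply: cvgM; last exact: continuous_cos.
    apply: cvgM; first exact: cvg_cst.
    by apply: cvgB; [exact: cvg_cst|exact: continuous_sinX].
  apply: cvgV; first by rewrite expf_neq0// lt0r_neq0.
  exact: cS3.
- move=> t /sin_cos_gt0[s0 c0]; rewrite /dF mulr_gt0 ?invr_gt0 ?exprn_gt0//.
  by rewrite !mulr_gt0// subr_gt0 (le_lt_trans _ b4_gt1).
Qed.

(** Substitution x = (1 + b^2) r / (b^2 + r^2) with r = sin t. *)
Lemma ellipticK2 : ellipticK (2 * b * cos a / (1 + b ^+ 2)) / (1 + b ^+ 2) =
  \int[mu]_(t in `[0, pi / 2]) ((b ^+ 2 - sin t ^+ 2) / radical t).
Proof.
pose d : R := 1 + b ^+ 2.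
have d0 : 0 < d by rewrite ltr_pwDl// sqr_ge0.
have dn0 := lt0r_neq0 d0.
pose E t := b ^+ 2 + sin t ^+ 2.
have E0 t : 0 < E t by rewrite ltr_pwDl ?sqr_ge0// (lt_trans ltr01) ?b2_gt1.
have cE : continuous E.
  by move=> t; apply: cvgD; [exact: cvg_cst|exact: continuous_sinX].
have cE2 : continuous (fun t => E t ^+ 2).
  move=> t; apply: (@continuous_comp _ _ _ E (fun x => x ^+ 2)); first exact: cE.
  exact: exprn_continuous.
pose f t := d * ((b ^+ 2 - sin t ^+ 2) / radical t).
pose F t := d * sin t * (E t)^-1.
pose dF t := d * (b ^+ 2 - sin t ^+ 2) * cos t * (E t ^+ 2)^-1.
have cb : continuous (fun t => b ^+ 2 - sin t ^+ 2).
  by move=> t; apply: cvgB; [exact: cvg_cst|exact: continuous_sinX].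
have cg : continuous (fun t => (b ^+ 2 - sin t ^+ 2) / radical t).
  exact: continuous_div_radical.
have cf : continuous f by move=> t; apply: cvgM; [exact: cvg_cst|exact: cg].
have dFE t : is_derive t (1 : R) F (dF t).
  have dE : is_derive t (1 : R) E (2 * sin t * cos t).
    by rewrite /E; apply: is_derive_eq; rewrite /GRing.scale/=; ring.
  have dV := is_deriveV (lt0r_neq0 (E0 t)) dE.
  rewrite /F; apply: is_derive_eq.
  rewrite /dF.
  have -> : b ^+ 2 - sin t ^+ 2 = E t - 2 * sin t ^+ 2 by rewrite /E; ring.
  rewrite /GRing.scale/=; field; exact: lt0r_neq0.
have fE t : t \in `]0, pi / 2[ ->
  (Num.sqrt ((1 - F t ^+ 2) * (1 - (2 * b * cos a / d) ^+ 2 * F t ^+ 2)))^-1 * dF t = f t.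
  move=> /sin_cos_gt0[s0 c0].
  pose S := Num.sqrt (quartic (sin t)).
  have S0 : 0 < S by rewrite sqrtr_gt0 quartic_gt0 ?sin2_le1.
  have S2 : S ^+ 2 = quartic (sin t) by rewrite sqr_sqrtr// ltW// quartic_gt0 ?sin2_le1.
  pose T := Num.sqrt (b ^+ 4 - sin t ^+ 2).
  have T0 : 0 < T by rewrite sqrtr_gt0 b4_sub_sin2_gt0.
  have T2 : T ^+ 2 = b ^+ 4 - sin t ^+ 2 by rewrite sqr_sqrtr// ltW// b4_sub_sin2_gt0.
  have En0 := lt0r_neq0 (E0 t).
  have e1 : 1 - F t ^+ 2 = (cos t * T / E t) ^+ 2.
    have -> : 1 - F t ^+ 2 = (E t ^+ 2 - d ^+ 2 * sin t ^+ 2) / E t ^+ 2.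
      by rewrite /F; field.
    rewrite !exprMn exprVn T2 cos2sin2 /E /d; congr (_ / _); ring.
  have e2 : 1 - (2 * b * cos a / d) ^+ 2 * F t ^+ 2 = (S / E t) ^+ 2.
    have -> : 1 - (2 * b * cos a / d) ^+ 2 * F t ^+ 2 =
        (E t ^+ 2 - 4 * b ^+ 2 * cos a ^+ 2 * sin t ^+ 2) / E t ^+ 2.
      by rewrite /F; field; rewrite dn0 En0.
    rewrite expr_div_n S2 quarticE cos2sin2 /E; congr (_ / _); ring.
  rewrite e1 e2 -exprMn sqrtr_sqr gtr0_norm; last first.
    by rewrite !mulr_gt0 ?invr_gt0.
  rewrite /dF /f /radical -/S -/T.
  field; rewrite En0 (lt0r_neq0 T0) (lt0r_neq0 c0) (lt0r_neq0 S0)//.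
suff -> : ellipticK (2 * b * cos a / d) = \int[mu]_(t in `[0, pi / 2]) f t.
  by rewrite /f RintegralZl//; [rewrite mulrC mulKf|exact: continuous_integrable_itv].
apply: (@ellipticK_subst _ _ F dF f modulus2_lt1) => //.
- move=> t; apply: cvgM; last by apply: cvgV; [exact: lt0r_neq0|exact: cE].
  by apply: cvgM; [exact: cvg_cst|exact: continuous_sin].
- by rewrite /F sin0 mulr0 mul0r.
- by rewrite /F /E sin_pihalf mulr1 expr1n addrC -/d divff.
- move=> t _; apply: cvgM.
    apply: cvgM; last exact: continuous_cos.
    by apply: cvgM; [exact: cvg_cst|exact: cb].
  by apply: cvgV; [rewrite expf_neq0// lt0r_neq0|exact: cE2].
- move=> t /sin_cos_gt0[s0 c0]; rewrite /dF mulr_gt0 ?invr_gt0 ?exprn_gt0//.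
  by rewrite !mulr_gt0// b2_sub_sin2_gt0.
Qed.

Definition elliptic_gap : R :=
  \int[mu]_(t in `[0, pi / 2]) (2 * sin t ^+ 2 / radical t).

Lemma ellipticK_gap :
  ellipticK (2 * b * sin a / dist) / dist -
  ellipticK (2 * b * cos a / (1 + b ^+ 2)) / (1 + b ^+ 2) = elliptic_gap.
Proof.
rewrite ellipticK1 ellipticK2 -RintegralB//; last 2 first.
- apply/continuous_integrable_itv/continuous_div_radical => t.
  by apply: cvgD; [exact: cvg_cst|exact: continuous_sinX].
- apply/continuous_integrable_itv/continuous_div_radical => t.
  by apply: cvgB; [exact: cvg_cst|exact: continuous_sinX].
by apply: eq_Rintegral => t _; rewrite -mulrBl; congr (_ / _); ring.
Qed.

Lemma continuous_gap : continuous (fun t => 2 * sin t ^+ 2 / radical t).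
Proof.
apply: continuous_div_radical => t.
by apply: cvgM; [exact: cvg_cst|exact: continuous_sinX].
Qed.

Lemma integral_sin2 : \int[mu]_(t in `[0, pi / 2]) (2 * sin t ^+ 2) = pi / 2.
Proof.
rewrite -[RHS](wallis_fun0 R) -[RHS]Rintegral_flip; last exact: continuous_wallis_fun.
by apply: eq_Rintegral => t _; rewrite /wallis_fun expr0 mulr1 -(opprB t) cosN cosBpihalf.
Qed.

(** Division by the Lauricella function is legitimate because of this.  The radical
    is at most (1 + b^2) b^2, and 2 sin^2 t has integral pi/2. *)
Lemma elliptic_gap_gt0 : 0 < elliptic_gap.
Proof.
pose M : R := Num.sqrt ((1 + b ^+ 2) ^+ 2) * Num.sqrt (b ^+ 4).
have M0 : 0 < M.
  by rewrite mulr_gt0// sqrtr_gt0 exprn_gt0 ?ltr_pwDl ?sqr_ge0// (lt_trans ltr01).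
(* sin^2 a <= 1 bounds the quartic by (b^2 + sin^2 t)^2. *)
have radM t : radical t <= M.
  have s0 := sqr_ge0 (sin t); have s1 := sin2_le1 t.
  apply: ler_pM; rewrite ?sqrtr_ge0//; apply: ler_wsqrtr; last by rewrite lerBlDr lerDl.
  apply: (@le_trans _ _ ((b ^+ 2 + sin t ^+ 2) ^+ 2)).
    rewrite quarticE (sin2cos2 a) -subr_ge0.
    rewrite (_ : _ - _ = 4 * b ^+ 2 * cos a ^+ 2 * sin t ^+ 2); last by ring.
    by rewrite mulr_ge0 ?sqr_ge0// mulr_ge0 ?sqr_ge0// mulr_ge0 ?sqr_ge0.
  by rewrite ler_pXn2r ?nnegrE ?addr_ge0 ?sqr_ge0// addrC lerD2r.
apply: (@lt_le_trans _ _ (M^-1 * (pi / 2))).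
  by rewrite mulr_gt0 ?invr_gt0// divr_gt0// pi_gt0.
have cs : continuous (fun t : R => 2 * sin t ^+ 2).
  by move=> t; apply: cvgM; [exact: cvg_cst|exact: continuous_sinX].
rewrite -integral_sin2 -RintegralZl//; last exact: continuous_integrable_itv.
apply: le_Rintegral => //.
- by apply: continuous_integrable_itv => t; apply: cvgM; [exact: cvg_cst|exact: cs].
- by apply: continuous_integrable_itv; exact: continuous_gap.
- move=> t _; rewrite mulrC ler_wpM2l//; first by rewrite pmulr_rge0// sqr_ge0.
  by rewrite lef_pV2 ?posrE// radical_gt0.
Qed.

End RadicalIntegrals.

(** * The Lauricella function at the given arguments *)

Section Evaluation.
Variable R : realType.
Implicit Types (x r s t u k : R) (z w : R[i]).
Local Notation normc := (@Normc.normc R).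
Local Notation mu := (@lebesgue_measure R).

(** Continuation and series give the same integral, so that the case
    distinction in the definition of F_D disappears. *)
Lemma lauricellaDE x z : x < 1 -> complex.Re z < 1 ->
  lauricellaD (2^-1) (half_tuple R) 2 (real_conj_tuple x z) =
  (2 / pi * \int[mu]_(t in `[0, pi / 2])
      (2 * cos t ^+ 2 * euler_kernel x z (sin t ^+ 2)))%:C.
Proof.
move=> x1 z1; rewrite /lauricellaD; case: ifPn => [/forallP H|_].
  apply: lauricellaD_seriesE.
    have := H ord0; rewrite (tnth_nth 0)/= normcE normc_real.
    by rewrite -[1](rmorph1 (real_complex R)) ltcR.
  have := H (inord 1); rewrite (tnth_nth 0)/= inordK//= normcE.
  by rewrite -[1](rmorph1 (real_complex R)) ltcR.
exact: lauricellaD_integralE.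
Qed.

Lemma cexp_imaginary r : cexp (0 +i* r) = cos r +i* sin r.
Proof. by rewrite /cexp /= expR0 mul1r. Qed.

Variables a b : R.
Hypothesis b1 : 1 < b.

(** The number 1 - b^2 e^(- 2 i a), whose inverse is the second argument of the
    Lauricella function. *)
Definition z0 : R[i] := (1 - b ^+ 2 * cos (2 * a)) +i* (b ^+ 2 * sin (2 * a)).

Lemma normc_z0_sub u : normc (z0 - u%:C) ^+ 2 =
  (1 - u) ^+ 2 - 2 * b ^+ 2 * cos (2 * a) * (1 - u) + b ^+ 4.
Proof.
rewrite /= sqr_sqrtr ?addr_ge0 ?sqr_ge0// subr0 exprMn sin2cos2.
ring.
Qed.

Lemma normc_z0 : normc z0 = dist a b.
Proof.
apply/eqP; rewrite -(@eqrXn2 _ 2) ?normc_ge0 ?sqrtr_ge0//.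
rewrite -[z0]subr0 -(rmorph0 (real_complex R)) normc_z0_sub sqr_dist// /quartic.
by apply/eqP; ring.
Qed.

(** The imaginary part of z0 may vanish, but the real part of its inverse is less
    than 1 in all cases, because cos (2 a) <= 1 < b^2. *)
Lemma Re_z0V_lt1 : complex.Re z0^-1 < 1.
Proof.
have D0 := dist_gt0 a b1; have D2 := sqr_dist a b1.
have n2E : (1 - b ^+ 2 * cos (2 * a)) ^+ 2 + (b ^+ 2 * sin (2 * a)) ^+ 2 =
    dist a b ^+ 2.
  by rewrite D2 exprMn sin2cos2 /quartic; ring.
rewrite /= n2E ltr_pdivrMr ?exprn_gt0// mul1r D2 -subr_gt0.
rewrite (_ : _ - _ = b ^+ 2 * (b ^+ 2 - cos (2 * a))); last first.
  by rewrite /quartic; ring.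
have B := b2_gt1 b1.
by rewrite mulr_gt0 ?subr_gt0 ?(lt_trans ltr01 B)// (le_lt_trans (cos_le1 _) B).
Qed.

(** With s = 1 - sin^2 t = cos^2 t, the factors 1 - x u and |1 - z u| are
    (b^4 - s) / (b^4 - 1) and sqrt (P(cos t)) / D; this is the radical at
    the complementary angle. *)
Lemma euler_kernel_z0 t :
  euler_kernel (1 - b ^+ 4)^-1 z0^-1 (sin t ^+ 2) =
  Num.sqrt (b ^+ 4 - 1) * dist a b / radical a b (pi / 2 - t).
Proof.
have D0 := dist_gt0 a b1.
have B0 : 0 < b ^+ 4 - 1 by rewrite subr_gt0 b4_gt1.
have zn0 : z0 != 0.
  by apply/eqP => z00; move: D0; rewrite -normc_z0 z00 Normc.normc0 ltxx.
rewrite /euler_kernel /radical.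
have -> : sin (pi / 2 - t) = cos t by rewrite -opprB sinN sinBpihalf opprK.
have -> : 1 - (1 - b ^+ 4)^-1 * sin t ^+ 2 = (b ^+ 4 - cos t ^+ 2) / (b ^+ 4 - 1).
  rewrite sin2cos2; field; rewrite !subr_eq0 (gt_eqF (b4_gt1 b1)) (lt_eqF (b4_gt1 b1))//.
have -> : 1 - z0^-1 * (sin t ^+ 2)%:C = (z0 - (sin t ^+ 2)%:C) / z0.
  by rewrite mulrBl divff// mulrC.
rewrite Normc.normcM Normc.normcV normc_z0.
have -> : normc (z0 - (sin t ^+ 2)%:C) = Num.sqrt (quartic a b (cos t)).
  rewrite -[LHS]ger0_norm ?normc_ge0// -sqrtr_sqr normc_z0_sub -cos2sin2.
  by congr (Num.sqrt _); rewrite /quartic; ring.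
rewrite sqrtrM; last by rewrite ltW// subr_gt0 (le_lt_trans (cos2_le1 t)) ?b4_gt1.
rewrite sqrtrV ?ltW//.
rewrite !invfM !invrK; ring.
Qed.

Lemma lauricellaD_gap :
  lauricellaD (2^-1) (half_tuple R) 2 (real_conj_tuple (1 - b ^+ 4)^-1 z0^-1) =
  (2 / pi * (Num.sqrt (b ^+ 4 - 1) * dist a b * elliptic_gap a b))%:C.
Proof.
rewrite lauricellaDE; last exact: Re_z0V_lt1; last first.
  by rewrite (@lt_trans _ _ 0)// invr_lt0 subr_lt0 b4_gt1.
congr ((_ * _)%:C).
pose h t := 2 * sin t ^+ 2 / radical a b t.
have ch : continuous h by exact: continuous_gap.
have chf : continuous (fun t => h (pi / 2 - t)).
  move=> t; apply: (@continuous_comp _ _ _ (fun t : R => pi / 2 - t) h).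
    by apply: cvgB; [exact: cvg_cst|exact: cvg_id].
  exact: ch.
rewrite /elliptic_gap -/h -(Rintegral_flip ch) -RintegralZl//; last first.
  exact: continuous_integrable_itv.
apply: eq_Rintegral => t _; rewrite euler_kernel_z0 /h.
have -> : sin (pi / 2 - t) = cos t by rewrite -opprB sinN sinBpihalf opprK.
by ring.
Qed.

End Evaluation.

Theorem theorem3p10 (R : realType) (a b : R) (hb : 1 < b) :
  (pi : R)%:C =
    (2 * Num.sqrt (b ^+ 4 - 1)
       * Num.sqrt (1 - 2 * b ^+ 2 * cos (2 * a) + b ^+ 4))%:C
    / lauricellaD (2^-1) [tuple 2^-1; 2^-1; 2^-1] 2
        [tuple (1 - b%:C ^+ 4)^-1;
               (1 - b%:C ^+ 2 * cexp (- (2 * 'i%C * a%:C)))^-1;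
               (1 - b%:C ^+ 2 * cexp (2 * 'i%C * a%:C))^-1]
    * (ellipticK (2 * b * sin a
           / Num.sqrt (1 - 2 * b ^+ 2 * cos (2 * a) + b ^+ 4))
         / Num.sqrt (1 - 2 * b ^+ 2 * cos (2 * a) + b ^+ 4)
       - ellipticK (2 * b * cos a / (1 + b ^+ 2)) / (1 + b ^+ 2))%:C.
Proof.
have x1E : (1 - b%:C ^+ 4)^-1 = ((1 - b ^+ 4)^-1)%:C.
  by rewrite fmorphV rmorphB rmorph1 rmorphXn.
have iaE : 2 * 'i%C * a%:C = 0 +i* (2 * a).
  rewrite -[2](rmorph_nat (real_complex R)); simpc; reflexivity.
have z2E : (1 - b%:C ^+ 2 * cexp (- (2 * 'i%C * a%:C)))^-1 = (z0 a b)^-1.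
  rewrite iaE (_ : - (0 +i* (2 * a)) = 0 +i* (- (2 * a))); last by simpc.
  rewrite cexp_imaginary cosN sinN -rmorphXn; congr (_^-1).
  by apply/eqP; rewrite eq_complex/=; apply/andP; split; apply/eqP; ring.
have z3E : (1 - b%:C ^+ 2 * cexp (2 * 'i%C * a%:C))^-1 = conjc (z0 a b)^-1.
  rewrite iaE cexp_imaginary -rmorphXn conjc_inv; congr (_^-1).
  by apply/eqP; rewrite eq_complex/=; apply/andP; split; apply/eqP; ring.
rewrite x1E z2E z3E -/(half_tuple R) -/(real_conj_tuple _ _) lauricellaD_gap//.
rewrite -/(dist a b) ellipticK_gap//.
rewrite -fmorphV -!rmorphM; congr (_%:C).
have G0 := lt0r_neq0 (elliptic_gap_gt0 a hb).
have D0 := lt0r_neq0 (dist_gt0 a hb).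
have B0 : Num.sqrt (b ^+ 4 - 1) != 0.
  by apply: lt0r_neq0; rewrite sqrtr_gt0 subr_gt0 b4_gt1.
have p0 := lt0r_neq0 (pi_gt0 R).
move: (elliptic_gap a b) (dist a b) (Num.sqrt (b ^+ 4 - 1)) (pi : R) G0 D0 B0 p0.
by move=> G D B p G0 D0 B0 p0; field; rewrite p0 G0 D0 B0.
Qed.
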